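(* Fix $N=4m$ with $m\ge1$. For every $Z\in S=\bigcup_{\gamma\in\Gamma(N)}\mathfrak h_n^\gamma$ there is a unique $\gamma=\begin{pmatrix}A&B\\C&D\end{pmatrix}\in\Gamma(N)$ with $\gamma Z=-\overline Z$; let $\kappa_Z(M)={}^t(CZ+D)\overline M$ and $\mathcal A_Z=(A_Z,H_Z,\kappa_Z,\{F_Z(e_i/N),F_Z(f_j/N)\})$. Then $\mathcal A_Z$ is a real principally polarized abelian variety with level $N$ structure, and the association $Z\mapsto\mathcal A_Z$ induces a bijection between the points of $X_{\mathbb R}$ (the fixed points of the involution induced by $Z\mapsto-\overline Z$ on $X=\Gamma(N)\backslash\mathfrak h_n$) and the set of isomorphism classes of real principally polarized abelian varieties with level $N$ structure.
   Context: $\mathbf{Sp}(2n,\mathbb R)$: real $2n\times 2n$ matrices $g=\begin{pmatrix}A&B\\C&D\end{pmatrix}$ with ${}^tgJg=J$, $J=\begin{pmatrix}0&I\\-I&0\end{pmatrix}$; $\mathfrak h_n=\{Z\in M_n(\mathbb C):{}^tZ=Z,\mathrm{Im}Z>0\}$ with action $gZ=(AZ+B)(CZ+D)^{-1}$; $\mathfrak h_n^\gamma=\{Z:\gamma Z=-\overline Z\}$; $\Gamma(N)=\{\gamma\in\mathbf{Sp}(2n,\mathbb Z):\gamma\equiv I\bmod N\}$. Abelian varieties: a principally polarized abelian variety is a pair $(A=\mathbb C^n/L,H)$ with $H$ a positive definite Hermitian form on $\mathbb C^n$, $Q=\mathrm{Im}H$, and $L$ a lattice having a basis (called symplectic) in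 which the matrix of $Q$ is $\begin{pmatrix}0&I\\-I&0\end{pmatrix}$. A real structure is a complex antilinear involution $\kappa$ of $\mathbb C^n$ with $\kappa(L)=L$ and $Q(\kappa u,\kappa v)=-Q(u,v)$. A level $N$ structure is a basis $\{U_i,V_j\}_{1\le i,j\le n}$ of the $N$-torsion points of $A$ such that for some symplectic basis $\{u_i,v_j\}$ of $L$ (a ''lift'') $U_i\equiv u_i/N$, $V_j\equiv v_j/N \bmod L$; it is compatible with $\kappa$ if, for a lift, $\kappa(u_i/N)\equiv -u_i/N$ and $\kappa(v_j/N)\equiv v_j/N\bmod L$ for all $i,j$. A real principally polarized abelian variety with level $N$ structure is a quadruple $(A,H,\kappa,\{U_i,V_j\})$ with compatible level structure. An isomorphism $(A,H,\kappa,\{U_i,V_j\})\to(A',H',\kappa',\{U_i',V_j'\})$ is a complex linear $\phi:\mathbb C^n\to\mathbb C^n$ with $\phi(L)=L'$, $H'(\phi u,\phi v)=H(u,v)$, $\phi\kappa\phi^{-1}=\kappa'$, and $\phi(u_i/N)\equiv u_i'/N$, $\phi(v_j/N)\equiv v_j'/N\bmod L'$ for lifts. For $Z\in\mathfrak h_n$: $F_Z:\mathbb R^n\oplus\mathbb R^n\to\mathbb C^n$, $F_Z(x,y)=Zx+y$; $L_Z=F_Z(\mathbb Z^n\oplus\mathbb Z^n)$; $H_Z(u,v)={}^tu(\mathrm{Im}Z)^{-1}\overline v$; $A_Z=\mathbb C^n/L_Z$; $\{e_i,f_j\}$ is the standard basis of $\mathbb R^n\oplus\mathbb R^n$, and $\{F_Z(e_i/N),F_Z(f_j/N)\}\bmod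 L_Z$ is the standard level $N$ structure. *)

(* Defs.v *)
From HB Require Import structures.
From mathcomp Require Import all_boot all_order all_algebra.
From mathcomp Require Import complex reals.
Set Implicit Arguments. Unset Strict Implicit. Unset Printing Implicit Defensive.
Import Order.TTheory GRing.Theory Num.Theory.
Local Open Scope ring_scope.

Definition Jmx (T : pzRingType) (n : nat) : 'M[T]_(n + n) :=
  block_mx 0 1%:M (- 1%:M) 0.

Definition symplectic_int (n : nat) (g : 'M[int]_(n + n)) : Prop :=
  g^T *m Jmx int n *m g = Jmx int n.

Definition GammaN (N n : nat) (g : 'M[int]_(n + n)) : Prop :=
  symplectic_int g /\ forall i j, (N%:Z %| g i j - (i == j)%:R)%Z.

Section Siegel.
Variable R : realType.
Local Notation C := (R[i]).

Definition intC (k : int) : C := k%:~R.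
Definition realC (x : R) : C := x%:C%C.
Definition intmxC (m p : nat) (g : 'M[int]_(m, p)) : 'M[C]_(m, p) := map_mx intC g.
Definition realmxC (m p : nat) (g : 'M[R]_(m, p)) : 'M[C]_(m, p) := map_mx realC g.
Definition intmxR (m p : nat) (g : 'M[int]_(m, p)) : 'M[R]_(m, p) :=
  map_mx (fun k : int => k%:~R) g.
Definition cjmx (m p : nat) (M : 'M[C]_(m, p)) : 'M[C]_(m, p) := map_mx (@conjc R) M.
Definition ImM (m p : nat) (M : 'M[C]_(m, p)) : 'M[R]_(m, p) := map_mx (@complex.Im R) M.

Definition posdefR (n : nat) (Y : 'M[R]_n) : Prop :=
  forall x : 'cV[R]_n, x != 0 -> 0 < (x^T *m Y *m x) 0 0.

Definition siegel (n : nat) (Z : 'M[C]_n) : Prop := Z^T = Z /\ posdefR (ImM Z).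

Definition sp_act (n : nat) (g : 'M[C]_(n + n)) (Z : 'M[C]_n) : 'M[C]_n :=
  (ulsubmx g *m Z + ursubmx g) *m invmx (dlsubmx g *m Z + drsubmx g).

(* S = union over gamma in Gamma(N) of h_n^gamma ; its Gamma(N)-orbits are X_R *)
Definition in_S (N n : nat) (Z : 'M[C]_n) : Prop :=
  siegel Z /\ exists g, GammaN N g /\ sp_act (intmxC g) Z = - cjmx Z.

Definition cat_fam (n : nat) (u v : 'I_n -> 'cV[C]_n) (k : 'I_(n + n)) : 'cV[C]_n :=
  match split k with inl i => u i | inr j => v j end.

Definition R_indep (n m : nat) (w : 'I_m -> 'cV[C]_n) : Prop :=
  forall c : 'I_m -> R, \sum_i realC (c i) *: w i = 0 -> forall i, c i = 0.
Definition Z_indep (n m : nat) (w : 'I_m -> 'cV[C]_n) : Prop :=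
  forall c : 'I_m -> int, \sum_i intC (c i) *: w i = 0 -> forall i, c i = 0.
Definition Z_span (n m : nat) (w : 'I_m -> 'cV[C]_n) (x : 'cV[C]_n) : Prop :=
  exists c : 'I_m -> int, x = \sum_i intC (c i) *: w i.

(* a lattice in C^n: the Z-span of an R-basis of C^n (= 2n R-independent vectors) *)
Definition is_lattice (n : nat) (L : 'cV[C]_n -> Prop) : Prop :=
  exists w : 'I_(n + n) -> 'cV[C]_n, R_indep w /\ forall x, L x <-> Z_span w x.

Definition posdef_hermitian (n : nat) (H : 'cV[C]_n -> 'cV[C]_n -> C) : Prop :=
  [/\ forall u u' v, H (u + u') v = H u v + H u' v,
      forall (a : C) u v, H (a *: u) v = a * H u v,
      forall u v, H v u = conjc (H u v)
    & forall u, u != 0 -> 0 < H u u].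

Definition Qform (n : nat) (H : 'cV[C]_n -> 'cV[C]_n -> C) (u v : 'cV[C]_n) : R :=
  complex.Im (H u v).

Definition symp_basis (n : nat) (L : 'cV[C]_n -> Prop) (H : 'cV[C]_n -> 'cV[C]_n -> C)
    (u v : 'I_n -> 'cV[C]_n) : Prop :=
  [/\ forall x, L x <-> Z_span (cat_fam u v) x,
      Z_indep (cat_fam u v)
    & forall i j,
      [/\ Qform H (u i) (u j) = 0, Qform H (v i) (v j) = 0,
          Qform H (u i) (v j) = (i == j)%:R & Qform H (v i) (u j) = - (i == j)%:R]].

Definition ppav (n : nat) (L : 'cV[C]_n -> Prop) (H : 'cV[C]_n -> 'cV[C]_n -> C) : Prop :=
  [/\ is_lattice L, posdef_hermitian H & exists u v, symp_basis L H u v].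

Definition real_structure (n : nat) (L : 'cV[C]_n -> Prop) (H : 'cV[C]_n -> 'cV[C]_n -> C)
    (k : 'cV[C]_n -> 'cV[C]_n) : Prop :=
  [/\ forall u v, k (u + v) = k u + k v,
      forall (a : C) u, k (a *: u) = conjc a *: k u,
      forall u, k (k u) = u,
      forall x, L x <-> (exists u, L u /\ x = k u)
    & forall u v, Qform H (k u) (k v) = - Qform H u v].

(* data of a quadruple (A = C^n/L, H, kappa, {U_i, V_j}); points of A are
   represented by elements of C^n (representatives modulo L) *)
Record pav_data (n : nat) := PavData {
  pL : 'cV[C]_n -> Prop;
  pH : 'cV[C]_n -> 'cV[C]_n -> C;
  pk : 'cV[C]_n -> 'cV[C]_n;
  pU : 'I_n -> 'cV[C]_n;
  pV : 'I_n -> 'cV[C]_n }.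

Definition Ninv (N : nat) : C := (N%:R)^-1.

Definition level_lift (N n : nat) (A : pav_data n) (u v : 'I_n -> 'cV[C]_n) : Prop :=
  symp_basis (pL A) (pH A) u v /\
  forall i, pL A (pU A i - Ninv N *: u i) /\ pL A (pV A i - Ninv N *: v i).

Definition level_structure (N n : nat) (A : pav_data n) : Prop :=
  exists u v, level_lift N A u v.

Definition level_compatible (N n : nat) (A : pav_data n) : Prop :=
  exists u v, level_lift N A u v /\
    forall i, pL A (pk A (Ninv N *: u i) + Ninv N *: u i) /\
              pL A (pk A (Ninv N *: v i) - Ninv N *: v i).

Definition real_ppav_level (N n : nat) (A : pav_data n) : Prop :=
  [/\ ppav (pL A) (pH A), real_structure (pL A) (pH A) (pk A),
      level_structure N A & level_compatible N A].

Definition pav_iso (N n : nat) (A A' : pav_data n) (P : 'M[C]_n) : Prop :=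
  [/\ forall x, pL A' x <-> (exists u, pL A u /\ x = P *m u),
      forall u v, pH A' (P *m u) (P *m v) = pH A u v,
      P \in unitmx,
      forall x, P *m pk A (invmx P *m x) = pk A' x
    & exists u v u' v', [/\ level_lift N A u v, level_lift N A' u' v' &
        forall i, pL A' (P *m (Ninv N *: u i) - Ninv N *: u' i) /\
                  pL A' (P *m (Ninv N *: v i) - Ninv N *: v' i)]].

Definition pav_isomorphic (N n : nat) (A A' : pav_data n) : Prop :=
  exists P, pav_iso N A A' P.

Definition F_Z (n : nat) (Z : 'M[C]_n) (x y : 'cV[R]_n) : 'cV[C]_n :=
  Z *m realmxC x + realmxC y.

Definition L_Z (n : nat) (Z : 'M[C]_n) (w : 'cV[C]_n) : Prop :=
  exists x y : 'cV[int]_n, w = F_Z Z (intmxR x) (intmxR y).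

Definition H_Z (n : nat) (Z : 'M[C]_n) (u v : 'cV[C]_n) : C :=
  (u^T *m realmxC (invmx (ImM Z)) *m cjmx v) 0 0.

Definition kappa_Z (n : nat) (g : 'M[int]_(n + n)) (Z : 'M[C]_n) (M : 'cV[C]_n) : 'cV[C]_n :=
  (dlsubmx (intmxC g) *m Z + drsubmx (intmxC g))^T *m cjmx M.

Definition e_vec (n : nat) (i : 'I_n) : 'cV[R]_n := delta_mx i 0.

Definition A_Z (N n : nat) (g : 'M[int]_(n + n)) (Z : 'M[C]_n) : pav_data n :=
  @PavData n (L_Z Z) (H_Z Z) (kappa_Z g Z)
    (fun i => F_Z Z ((N%:R)^-1 *: e_vec i) 0)
    (fun j => F_Z Z 0 ((N%:R)^-1 *: e_vec j)).

End Siegel.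

(* Main.v *)
(** Write [Pi = (Z 1)] for the period matrix of [Z], so that [L_Z = Pi Z^(2n)] and the
    imaginary part of [Pi^T (Im Z)^-1 Pi^*] is [J].  A linear map between two such
    varieties is an integral matrix [M] with [P Pi = Pi' M]; it preserves the
    polarizations iff [M] is symplectic, the level structures iff [M = 1 mod N], and
    [P Pi = Pi' M] says that [M^-T] carries [Z] to [Z'].  In the same way, antilinear maps
    are integral matrices [E] with [K Pi^* = Pi E]; for [gamma Z = - Z^*] the matrix of
    [kappa_Z] is [E = gamma^T tau] with [tau = diag(-1, 1)], and conversely every
    compatible real structure produces such a [gamma].

    The only non-formal input is rigidity: an automorphism that is trivial on the
    [N]-torsion, [N >= 4], is the identity (Minkowski).  Applied to the composite of two
    real structures, it yields the uniqueness of [gamma], that [kappa_Z] is an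
    involution, and that an isomorphism of polarized varieties with level structure
    automatically commutes with the real structures.  Surjectivity is the normal form
    [Z = V^-1 U] of the period matrix [(U V)] of a symplectic basis. *)

From Pilot Require Import Defs.
From HB Require Import structures.
From mathcomp Require Import all_boot all_order all_algebra.
From mathcomp Require Import complex reals.
From mathcomp Require Import ring lra.
Set Implicit Arguments. Unset Strict Implicit. Unset Printing Implicit Defensive.
Import Order.TTheory GRing.Theory Num.Theory.
(* [Num.Theory] has its own [ImM] and [realmxC]. *)
Import Pilot.Defs.
Local Open Scope ring_scope.

(** * Minkowski's lemma *)

Lemma unitmx_cker (F : fieldType) (n : nat) (A : 'M[F]_n) :
  (forall x : 'cV_n, A *m x = 0 -> x = 0) -> A \in unitmx.
Proof.
move=> A_inj; rewrite -unitmx_tr -row_free_unit -kermx_eq0.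
apply/eqP/row_matrixP => i; rewrite row0; apply: trmx_inj; rewrite trmx0.
by apply: A_inj; rewrite -{1}[A]trmxK -trmx_mul -row_mul mulmx_ker row0 trmx0.
Qed.

(** * Positive definite bilinear forms over the reals *)

Section BilinearForm.
Variables (R : realType) (n : nat) (S : 'M[R]_n).

Definition bil (x y : 'cV[R]_n) : R := (x^T *m S *m y) 0 0.

Lemma bilDl x x' y : bil (x + x') y = bil x y + bil x' y.
Proof. by rewrite /bil linearD /= !mulmxDl mxE. Qed.

Lemma bilDr x y y' : bil x (y + y') = bil x y + bil x y'.
Proof. by rewrite /bil mulmxDr mxE. Qed.

Lemma bilZl a x y : bil (a *: x) y = a * bil x y.
Proof. by rewrite /bil linearZ /= -!scalemxAl mxE. Qed.

Lemma bilZr a x y : bil x (a *: y) = a * bil x y.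
Proof. by rewrite /bil -scalemxAr mxE. Qed.

Lemma bilM (M : 'M[R]_n) x y : M^T *m S *m M = S -> bil (M *m x) (M *m y) = bil x y.
Proof. by move=> MS; rewrite /bil -[in RHS]MS trmx_mul !mulmxA. Qed.

Hypothesis S_pos : posdefR S.

Lemma bil_ge0 x : 0 <= bil x x.
Proof.
have [->|/S_pos/ltW//] := eqVneq x 0.
by rewrite /bil mulmx0 mxE.
Qed.

Lemma bil_eq0 x : bil x x = 0 -> x = 0.
Proof. by move=> q0; apply/eqP/negPn/negP => /S_pos; rewrite -/(bil x x) q0 ltxx. Qed.

Lemma posdefR_unit : S \in unitmx.
Proof. by apply: unitmx_cker => x Sx; apply: bil_eq0; rewrite /bil -mulmxA Sx mulmx0 mxE. Qed.

Hypothesis S_sym : S^T = S.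

Lemma bilC x y : bil x y = bil y x.
Proof.
by rewrite /bil -[in RHS]S_sym -[in LHS](trmxK (_ *m _)) mxE !trmx_mul trmxK mulmxA S_sym.
Qed.

Lemma bil_cauchy_schwarz x y : bil x y ^+ 2 <= bil x x * bil y y.
Proof.
have [->|y0] := eqVneq y 0; first by rewrite /bil !mulmx0 mxE mulr0 expr0n.
have y_gt0 : 0 < bil y y := S_pos y0.
(* The form is evaluated at the component of [x] orthogonal to [y]. *)
have := bil_ge0 (x + (- (bil x y / bil y y)) *: y).
rewrite bilDl !bilDr !bilZl !bilZr (bilC y x).
set a := bil x x; set b := bil x y; set c := bil y y.
rewrite (_ : _ + _ = a - b ^+ 2 / c); last by field; rewrite lt0r_neq0.
by rewrite subr_ge0 ler_pdivrMr.
Qed.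

(** The coordinate [x i 0] is the pairing of [x] with [invmx S] applied to the [i]th basis vector,
    so Cauchy-Schwarz bounds it; summing over [i] makes the constant uniform. This lets smallness of
    the form force an integral vector to vanish. *)
Lemma coord_le_bil :
  exists2 c, 0 <= c & forall i (x : 'cV[R]_n), x i 0 ^+ 2 <= c * bil x x.
Proof.
pose d i := invmx S *m delta_mx i (0 : 'I_1).
exists (\sum_i bil (d i) (d i)); first by apply: sumr_ge0 => i _; apply: bil_ge0.
move=> i x; apply: le_trans (_ : bil (d i) (d i) * bil x x <= _).
  have -> : x i 0 = bil (d i) x; last exact: bil_cauchy_schwarz.
  rewrite bilC /bil mulmxA mulmxK ?posdefR_unit // mxE (bigD1 i) //=.
  rewrite big1 => [|j ji]; first by rewrite !mxE !eqxx mulr1 addr0.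
  by rewrite !mxE (negPf ji) mulr0.
apply: ler_wpM2r; first exact: bil_ge0.
by rewrite (bigD1 i) //= lerDl sumr_ge0 // => j _; apply: bil_ge0.
Qed.

End BilinearForm.

Lemma intmxRM (R : realType) (m n p : nat) (A : 'M[int]_(m, n)) (B : 'M[int]_(n, p)) :
  intmxR R (A *m B) = intmxR R A *m intmxR R B.
Proof. exact: (map_mxM (intmul 1)). Qed.

Lemma intmxR_inj (R : realType) (m n : nat) : injective (@intmxR R m n).
Proof.
by move=> A B /matrixP AB; apply/matrixP => i j; have := AB i j; rewrite !mxE => /intr_inj.
Qed.

(* Minkowski's lemma, by descent: if [M = 1 + N B] is an isometry then [B] contracts
   the form by [4 / N^2], so discreteness of the integers makes [B] nilpotent; and
   [B (B v) = 0] forces [B v = 0] because [M] is an isometry fixing [B v]. *)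
Lemma minkowski (R : realType) (n N : nat) (S : 'M[R]_n) (M : 'M[int]_n) :
    (4 <= N)%N -> posdefR S -> S^T = S ->
    (intmxR R M)^T *m S *m intmxR R M = S ->
    (forall i j, (N%:Z %| M i j - (i == j)%:R)%Z) -> M = 1%:M.
Proof.
move=> N4 S_pos S_sym MS M1.
pose B : 'M[int]_n := \matrix_(i, j) ((M i j - (i == j)%:R) %/ N%:Z)%Z.
have MB : M = 1%:M + N%:Z *: B.
  by apply/matrixP => i j; rewrite !mxE mulrC divzK ?M1 // addrC subrK.
have N_gt0 : 0 < N%:R :> R by rewrite ltr0n; apply: leq_trans N4.
pose q (w : 'cV[int]_n) := bil S (intmxR R w) (intmxR R w).
have MwE (w : 'cV[int]_n) :
    intmxR R M *m intmxR R w = intmxR R w + N%:R *: intmxR R (B *m w).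
  rewrite -intmxRM MB mulmxDl mul1mx -scalemxAl; apply/matrixP => i j.
  by rewrite !mxE rmorphD rmorphM.
(* With [a], [b], [c] the values at [(x, x)], [(x, y)], [(y, y)], the isometry gives
   [2 N b = - N^2 c] and positivity at [2 x + N y] gives [4 a + 4 N b + N^2 c >= 0]. Together
   [N^2 c <= 4 a], and [N^2 >= 16]. *)
have contract w : q (B *m w) <= q w / 4.
  set x := intmxR R w; set y := intmxR R (B *m w).
  have isom : bil S (x + N%:R *: y) (x + N%:R *: y) = q w by rewrite -MwE (bilM _ _ MS).
  have := bil_ge0 S_pos (x + x + N%:R *: y).
  have : N%:R ^+ 2 * q (B *m w) >= 16 * q (B *m w).
    apply: ler_wpM2r; first exact: bil_ge0.
    by rewrite -natrX ler_nat (leq_sqr 4).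
  move: isom; rewrite /q -/x -/y.
  rewrite !(bilDl, bilDr, bilZl, bilZr) (bilC S_sym y x).
  set a := bil S x x; set b := bil S x y; set c := bil S y y.
  set r := N%:R; nra.
have q_iter k w : q (iter k (mulmx B) w) <= q w / 4 ^+ k.
  elim: k => [|k IHk] /=; first by rewrite expr0 divr1.
  apply: le_trans (contract _) _; rewrite exprSr invfM mulrA.
  by rewrite ler_wpM2r // invr_ge0.
have nilp (w : 'cV[int]_n) : exists k, iter k (mulmx B) w = 0.
  have [c c_ge0 c_coord] := coord_le_bil S_pos S_sym.
  (* As [k < 4 ^ k], this [k] makes the square of every coordinate of the iterate less than 1, so
     these integers are 0. *)
  exists (Num.bound (c * q w)); set k := Num.bound _.
  have ltk : c * q w < 4 ^+ k.
    apply: lt_trans (archi_boundP _) _; first by rewrite mulr_ge0 ?bil_ge0.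
    by rewrite -natrX ltr_nat ltn_expl.
  set z := iter k _ _; apply/matrixP => i j; rewrite ord1 [RHS]mxE.
  have := c_coord i (intmxR R z); rewrite mxE => z_le.
  have : ((z i 0)%:~R : R) ^+ 2 < 1.
    apply: le_lt_trans z_le _.
    apply: le_lt_trans (ler_wpM2l c_ge0 (q_iter k w)) _.
    by rewrite mulrA ltr_pdivrMr ?exprn_gt0 // mul1r.
  rewrite -(rmorphXn (intmul 1)) /= -[1]/(1%:~R) ltr_int => z_lt1.
  have : z i 0 ^+ 2 = 0.
    by apply/eqP; rewrite eq_le sqr_ge0 andbT -ltzD1 add0r.
  by move/eqP; rewrite sqrf_eq0 => /eqP.
have Bker (w : 'cV[int]_n) : B *m (B *m w) = 0 -> B *m w = 0.
  move=> BBw0; apply: (@intmxR_inj R); set y := intmxR R (B *m w).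
  have -> : intmxR R (0 : 'cV[int]_n) = 0 by exact: (map_mx0 (intmul 1)).
  apply: (bil_eq0 S_pos).
  have My : intmxR R M *m y = y.
    rewrite MwE BBw0 -/y.
    have -> : intmxR R (0 : 'cV[int]_n) = 0 by exact: (map_mx0 (intmul 1)).
    by rewrite scaler0 addr0.
  (* Pairing [M w = w + N y] with [M y = y] must give the pairing of [w] with [y], which leaves [N]
     times the form at [y] equal to 0. *)
  have := bilM (intmxR R w) y MS.
  rewrite My MwE bilDl bilZl -/y => /eqP.
  by rewrite -subr_eq0 addrC addKr mulf_eq0 gt_eqF //= => /eqP.
have Bw0 (w : 'cV[int]_n) : B *m w = 0.
  have [k] := nilp w; elim: k => [/= ->|k IHk /=]; first by rewrite mulmx0.
  by case: k IHk => [//|k] IHk /= /Bker /IHk.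
rewrite MB; suff -> : B = 0 by rewrite scaler0 addr0.
apply/matrixP => i j; have := Bw0 (delta_mx j 0).
by rewrite -colE => /matrixP /(_ i 0); rewrite !mxE.
Qed.

(** * Complex matrices *)

(** The two coercions are declared ring morphisms so that the [map_mx] lemmas apply to [intmxC] and
    [realmxC]. *)
HB.instance Definition _ (R : realType) :=
  GRing.RMorphism.copy (@intC R) (intmul (1 : R[i])).
HB.instance Definition _ (R : realType) :=
  GRing.RMorphism.copy (@realC R) (real_complex R).

Section ComplexMatrices.
Variable R : realType.
Local Notation C := (R[i]).

Definition ReM (m p : nat) (M : 'M[C]_(m, p)) : 'M[R]_(m, p) := map_mx (@complex.Re R) M.

Lemma ReD (x y : C) : complex.Re (x + y) = complex.Re x + complex.Re y.
Proof. by case: x y => [a b] [c d]. Qed.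

Lemma ImD (x y : C) : complex.Im (x + y) = complex.Im x + complex.Im y.
Proof. by case: x y => [a b] [c d]. Qed.

Lemma Re_sum (I : finType) (F : I -> C) :
  complex.Re (\sum_i F i) = \sum_i complex.Re (F i).
Proof. by apply: (big_morph _ ReD). Qed.

Lemma Im_sum (I : finType) (F : I -> C) :
  complex.Im (\sum_i F i) = \sum_i complex.Im (F i).
Proof. by apply: (big_morph _ ImD). Qed.

Lemma ReM_mul m n p (A : 'M[C]_(m, n)) (B : 'M[C]_(n, p)) :
  ReM (A *m B) = ReM A *m ReM B - ImM A *m ImM B.
Proof.
apply/matrixP => i j; rewrite !mxE Re_sum -sumrB; apply: eq_bigr => k _.
by rewrite !mxE; case: (A i k) (B k j) => [a b] [c d].
Qed.

Lemma ImM_mul m n p (A : 'M[C]_(m, n)) (B : 'M[C]_(n, p)) :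
  ImM (A *m B) = ReM A *m ImM B + ImM A *m ReM B.
Proof.
apply/matrixP => i j; rewrite !mxE Im_sum -big_split; apply: eq_bigr => k _ /=.
by rewrite !mxE; case: (A i k) (B k j) => [a b] [c d].
Qed.

Section Shape.
Variables m p : nat.
Implicit Types A B : 'M[C]_(m, p).

Lemma eqmxC A B : ReM A = ReM B -> ImM A = ImM B -> A = B.
Proof.
move=> /matrixP re /matrixP im; apply/matrixP => i j.
have := re i j; have := im i j; rewrite !mxE.
by case: (A i j) (B i j) => [a b] [c d] /= -> ->.
Qed.

Lemma ReM_add A B : ReM (A + B) = ReM A + ReM B.
Proof. by apply/matrixP => i j; rewrite !mxE ReD. Qed.
Lemma ImM_add A B : ImM (A + B) = ImM A + ImM B.
Proof. by apply/matrixP => i j; rewrite !mxE ImD. Qed.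
Lemma ImM_opp A : ImM (- A) = - ImM A.
Proof. by apply/matrixP => i j; rewrite !mxE; case: (A i j). Qed.
Lemma ReM_cj A : ReM (cjmx A) = ReM A.
Proof. by apply/matrixP => i j; rewrite !mxE; case: (A i j). Qed.
Lemma ImM_cj A : ImM (cjmx A) = - ImM A.
Proof. by apply/matrixP => i j; rewrite !mxE; case: (A i j). Qed.
Lemma ReM_tr A : ReM A^T = (ReM A)^T.
Proof. by apply/matrixP => i j; rewrite !mxE. Qed.
Lemma ImM_tr A : ImM A^T = (ImM A)^T.
Proof. by apply/matrixP => i j; rewrite !mxE. Qed.
Lemma ReM_real (A : 'M[R]_(m, p)) : ReM (realmxC A) = A.
Proof. by apply/matrixP => i j; rewrite !mxE. Qed.
Lemma ImM_real (A : 'M[R]_(m, p)) : ImM (realmxC A) = 0.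
Proof. by apply/matrixP => i j; rewrite !mxE. Qed.
Lemma ReM0 : ReM (0 : 'M[C]_(m, p)) = 0.
Proof. by apply/matrixP => i j; rewrite !mxE. Qed.
Lemma ImM0 : ImM (0 : 'M[C]_(m, p)) = 0.
Proof. by apply/matrixP => i j; rewrite !mxE. Qed.
Lemma cjmxK : involutive (@cjmx R m p).
Proof. by move=> A; apply/matrixP => i j; rewrite !mxE conjcK. Qed.
Lemma cjmx_real (A : 'M[R]_(m, p)) : cjmx (realmxC A) = realmxC A.
Proof. by apply/matrixP => i j; rewrite !mxE conjc_real. Qed.
Lemma realmxC_int (A : 'M[int]_(m, p)) : realmxC (intmxR R A) = intmxC R A.
Proof. by apply/matrixP => i j; rewrite !mxE rmorph_int. Qed.
Lemma cjmx_int (A : 'M[int]_(m, p)) : cjmx (intmxC R A) = intmxC R A.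
Proof. by rewrite -realmxC_int cjmx_real. Qed.
Lemma cjmxD A B : cjmx (A + B) = cjmx A + cjmx B.
Proof. exact: map_mxD. Qed.
Lemma cjmxZ a A : cjmx (a *: A) = conjc a *: cjmx A.
Proof. exact: map_mxZ. Qed.
Lemma realmxC_inj : injective (@realmxC R m p).
Proof. by move=> A B AB; rewrite -[A]ReM_real AB ReM_real. Qed.
Lemma cjmx_tr A : cjmx A^T = (cjmx A)^T.
Proof. by rewrite /cjmx map_trmx. Qed.
Lemma realmxC_tr (A : 'M[R]_(m, p)) : realmxC A^T = (realmxC A)^T.
Proof. by rewrite /realmxC map_trmx. Qed.
Lemma intmxC_tr (A : 'M[int]_(m, p)) : intmxC R A^T = (intmxC R A)^T.
Proof. by rewrite /intmxC map_trmx. Qed.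
Lemma intmxR_tr (A : 'M[int]_(m, p)) : intmxR R A^T = (intmxR R A)^T.
Proof. by rewrite /intmxR map_trmx. Qed.

End Shape.

Lemma ReM1 n : ReM (1%:M : 'M[C]_n) = 1%:M.
Proof. by apply/matrixP => i j; rewrite !mxE; case: eqP. Qed.
Lemma ImM1 n : ImM (1%:M : 'M[C]_n) = 0.
Proof. by apply/matrixP => i j; rewrite !mxE; case: eqP. Qed.
Lemma intmxC1 n : intmxC R (1%:M : 'M[int]_n) = 1%:M.
Proof. exact: map_mx1. Qed.
Lemma cjmx1 n : cjmx (1%:M : 'M[C]_n) = 1%:M.
Proof. exact: map_mx1. Qed.
Lemma cjmxM m n p (A : 'M[C]_(m, n)) (B : 'M[C]_(n, p)) : cjmx (A *m B) = cjmx A *m cjmx B.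
Proof. exact: map_mxM. Qed.
Lemma realmxCM m n p (A : 'M[R]_(m, n)) (B : 'M[R]_(n, p)) :
  realmxC (A *m B) = realmxC A *m realmxC B.
Proof. exact: map_mxM. Qed.
Lemma intmxCM m n p (A : 'M[int]_(m, n)) (B : 'M[int]_(n, p)) :
  intmxC R (A *m B) = intmxC R A *m intmxC R B.
Proof. exact: map_mxM. Qed.
Lemma ImM_row m n p (A : 'M[C]_(m, n)) (B : 'M[C]_(m, p)) :
  ImM (row_mx A B) = row_mx (ImM A) (ImM B).
Proof. exact: map_row_mx. Qed.
Lemma ReM_row m n p (A : 'M[C]_(m, n)) (B : 'M[C]_(m, p)) :
  ReM (row_mx A B) = row_mx (ReM A) (ReM B).
Proof. exact: map_row_mx. Qed.
Lemma cjmx_row m n p (A : 'M[C]_(m, n)) (B : 'M[C]_(m, p)) :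
  cjmx (row_mx A B) = row_mx (cjmx A) (cjmx B).
Proof. exact: map_row_mx. Qed.
Lemma intmxR_J n : intmxR R (Jmx int n) = Jmx R n.
Proof.
rewrite /Jmx /intmxR (map_block_mx (intmul 1)) (map_mx0 (intmul 1)) (map_mxN (intmul 1)).
by rewrite (map_mx1 (intmul 1)).
Qed.

Lemma Re_sesqui n (Y : 'M[R]_n) (v w : 'cV[C]_n) :
  complex.Re ((v^T *m realmxC Y *m cjmx w) 0 0) =
  bil Y (ReM v) (ReM w) + bil Y (ImM v) (ImM w).
Proof.
transitivity (ReM (v^T *m realmxC Y *m cjmx w) 0 0); first by rewrite [RHS]mxE.
rewrite !(ReM_mul, ImM_mul) !ReM_real !ImM_real ReM_cj ImM_cj ReM_tr ImM_tr.
by rewrite !mulmx0 add0r subr0 mulmxN opprK mxE.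
Qed.

Lemma Im_sesqui n (Y : 'M[R]_n) (v w : 'cV[C]_n) :
  complex.Im ((v^T *m realmxC Y *m cjmx w) 0 0) =
  bil Y (ImM v) (ReM w) - bil Y (ReM v) (ImM w).
Proof.
transitivity (ImM (v^T *m realmxC Y *m cjmx w) 0 0); first by rewrite [RHS]mxE.
rewrite !(ReM_mul, ImM_mul) !ReM_real !ImM_real ReM_cj ImM_cj ReM_tr ImM_tr.
by rewrite !mulmx0 add0r subr0 mulmxN addrC [LHS]mxE [X in _ + X]mxE.
Qed.

Lemma Re_sesqui_gt0 n (Y : 'M[R]_n) (v : 'cV[C]_n) :
  posdefR Y -> v != 0 -> 0 < complex.Re ((v^T *m realmxC Y *m cjmx v) 0 0).
Proof.
move=> Y_pos; rewrite Re_sesqui; apply: contraNT; rewrite -leNgt => le0.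
have [re_ge0 im_ge0] := (bil_ge0 Y_pos (ReM v), bil_ge0 Y_pos (ImM v)).
have re0 : bil Y (ReM v) (ReM v) = 0 by lra.
have im0 : bil Y (ImM v) (ImM v) = 0 by lra.
apply/eqP/eqmxC; rewrite ?ReM0 ?ImM0; exact: (bil_eq0 Y_pos).
Qed.

End ComplexMatrices.

(** * Period matrices *)

Section Periods.
Variables (R : realType) (n : nat).
Local Notation C := (R[i]).
Implicit Types Z : 'M[C]_n.

Definition period Z : 'M[C]_(n, n + n) := row_mx Z 1%:M.
Definition herm Z : 'M[C]_n := realmxC (invmx (ImM Z)).

Lemma siegel_cjN Z : siegel Z -> siegel (- cjmx Z).
Proof.
case=> Z_sym Z_pos; split; first by rewrite linearN /= -cjmx_tr Z_sym.
by rewrite ImM_opp ImM_cj opprK.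
Qed.

Lemma siegel_Im_unit Z : siegel Z -> ImM Z \in unitmx.
Proof. by case=> _ /posdefR_unit. Qed.

Lemma siegel_Im_sym Z : siegel Z -> (ImM Z)^T = ImM Z.
Proof. by case=> Z_sym _; rewrite -ImM_tr Z_sym. Qed.

Lemma siegel_Re_sym Z : siegel Z -> (ReM Z)^T = ReM Z.
Proof. by case=> Z_sym _; rewrite -ReM_tr Z_sym. Qed.

Lemma posdefR_inv (Y : 'M[R]_n) : posdefR Y -> Y^T = Y -> posdefR (invmx Y).
Proof.
move=> Y_pos Y_sym x x0; have Y_unit := posdefR_unit Y_pos.
have := Y_pos (invmx Y *m x); rewrite trmx_mul trmx_inv Y_sym !mulmxA mulmxKV //.
by apply; apply: contra x0 => /eqP Yx; rewrite -[x](mulKVmx Y_unit) Yx mulmx0.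
Qed.

Lemma mul_period_col Z p (A B : 'M[C]_(n, p)) : period Z *m col_mx A B = Z *m A + B.
Proof. by rewrite mul_row_col mul1mx. Qed.

Lemma realmxC_col m1 m2 p (A : 'M[R]_(m1, p)) (B : 'M[R]_(m2, p)) :
  realmxC (col_mx A B) = col_mx (realmxC A) (realmxC B).
Proof. exact: map_col_mx. Qed.

Lemma intmxC_col m1 m2 p (A : 'M[int]_(m1, p)) (B : 'M[int]_(m2, p)) :
  intmxC R (col_mx A B) = col_mx (intmxC R A) (intmxC R B).
Proof. exact: map_col_mx. Qed.

Lemma ReM_sandwich m1 m2 p q (A : 'M[R]_(m1, m2)) (H : 'M[C]_(m2, p)) (B : 'M[R]_(p, q)) :
  ReM (realmxC A *m H *m realmxC B) = A *m ReM H *m B.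
Proof. by rewrite !(ReM_mul, ImM_mul) !ReM_real !ImM_real mul0mx mulmx0 !subr0. Qed.

Lemma ImM_sandwich m1 m2 p q (A : 'M[R]_(m1, m2)) (H : 'M[C]_(m2, p)) (B : 'M[R]_(p, q)) :
  ImM (realmxC A *m H *m realmxC B) = A *m ImM H *m B.
Proof. by rewrite !(ReM_mul, ImM_mul) !ReM_real !ImM_real !mul0mx mulmx0 add0r addr0. Qed.

(** The imaginary part of [Z a + b] is [Im Z a], and [Im Z] is invertible; this is the real
    independence of the periods. *)
Lemma period_ker Z p (A : 'M[R]_(n + n, p)) :
  siegel Z -> period Z *m realmxC A = 0 -> A = 0.
Proof.
move=> sZ; rewrite -[A]vsubmxK; move: (usubmx A) (dsubmx A) => a b.
rewrite realmxC_col mul_period_col => eq0.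
have := congr1 (@ReM R _ _) eq0; have := congr1 (@ImM R _ _) eq0.
rewrite ImM_add ReM_add ImM_mul ReM_mul !ReM_real !ImM_real ReM0 ImM0 !mulmx0.
rewrite add0r addr0 subr0 => Ya.
have -> : a = 0 by rewrite -[a](mulKmx (siegel_Im_unit sZ)) Ya mulmx0.
by rewrite mulmx0 add0r => ->; rewrite col_mx0.
Qed.

Lemma period_inj Z p (A B : 'M[R]_(n + n, p)) :
  siegel Z -> period Z *m realmxC A = period Z *m realmxC B -> A = B.
Proof.
move=> sZ AB; apply: subr0_eq; apply: (period_ker sZ).
by rewrite /realmxC map_mxB mulmxBr -/(realmxC A) AB subrr.
Qed.

Lemma period_int_inj Z p (A B : 'M[int]_(n + n, p)) :
  siegel Z -> period Z *m intmxC R A = period Z *m intmxC R B -> A = B.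
Proof. by move=> sZ; rewrite -!realmxC_int => /(period_inj sZ) /intmxR_inj. Qed.

Lemma mul_period_inj Z (P P' : 'M[C]_n) : P *m period Z = P' *m period Z -> P = P'.
Proof. by rewrite !mul_mx_row !mulmx1 => /eq_row_mx []. Qed.

Lemma L_ZE Z w : L_Z Z w <-> exists k : 'cV[int]_(n + n), w = period Z *m intmxC R k.
Proof.
split=> [[x [y ->]]|[k ->]].
  by exists (col_mx x y); rewrite intmxC_col mul_period_col /F_Z !realmxC_int.
exists (usubmx k), (dsubmx k).
by rewrite -[in LHS](vsubmxK k) intmxC_col mul_period_col /F_Z !realmxC_int.
Qed.

Lemma Im_period Z : siegel Z ->
  ImM ((period Z)^T *m herm Z *m cjmx (period Z)) = Jmx R n.
Proof.
move=> sZ; have Yu := siegel_Im_unit sZ; have := siegel_Im_sym sZ; have := siegel_Re_sym sZ.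
rewrite ImM_mul !(ReM_mul, ImM_mul) /herm !ReM_real !ImM_real ReM_cj ImM_cj ReM_tr ImM_tr.
rewrite ReM_row ImM_row ReM1 ImM1 !mulmx0 subr0 add0r !tr_row_mx trmx1 trmx0.
move=> -> ->; set X := ReM Z; set Y := ImM Z.
rewrite opp_row_mx oppr0 !mul_col_mx !mul_mx_row !mul1mx !mul0mx !mulmx1 !mulmx0.
rewrite -[col_mx (row_mx (Y *m _ *m X) _) _]/(block_mx _ _ _ _) add_block_mx.
by rewrite !mulmxN mulmxKV ?mulmxV ?mulVmx // mul1mx addrC subrr !add0r !addr0.
Qed.

(** The right-hand blocks of the product are [Z D] and [D]. So [Im D = 0], hence
    [Im (Z D) = Im Z Re D = 0], and [Im Z] is invertible. *)
Lemma period_sesqui_eq0 Z (D : 'M[C]_n) : siegel Z ->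
  ImM ((period Z)^T *m D *m cjmx (period Z)) = 0 -> D = 0.
Proof.
move=> sZ; have [Z_sym _] := sZ.
rewrite cjmx_row tr_row_mx mul_col_mx mul_mx_row mul_col_mx.
rewrite trmx1 mul1mx cjmx1 !mulmx1 Z_sym.
rewrite /ImM map_row_mx !map_col_mx -!/(ImM _) => /eqP.
rewrite row_mx_eq0 !col_mx_eq0 => /andP[_ /andP[/eqP ZD /eqP ImD0]].
apply: eqmxC; rewrite ?ReM0 ?ImM0 //.
move: ZD; rewrite ImM_mul ImD0 mulmx0 add0r => YD.
by rewrite -[ReM D](mulKmx (siegel_Im_unit sZ)) YD mulmx0.
Qed.

Lemma herm_tr Z : siegel Z -> (herm Z)^T = herm Z.
Proof. by move=> sZ; rewrite /herm -realmxC_tr trmx_inv siegel_Im_sym. Qed.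

Lemma herm_cj Z : cjmx (herm Z) = herm Z.
Proof. exact: cjmx_real. Qed.

Lemma H_Z_gt0 Z u : siegel Z -> u != 0 -> 0 < H_Z Z u u.
Proof.
move=> sZ u0; have [_ Y_pos] := sZ; have Y_sym := siegel_Im_sym sZ.
have Yi_pos := posdefR_inv Y_pos Y_sym.
rewrite ltcE (Re_sesqui_gt0 Yi_pos u0) andbT Im_sesqui bilC ?subrr //.
by rewrite trmx_inv Y_sym.
Qed.

(* A Hermitian form is determined by its imaginary part, so it is enough that the
   rational representation [M] be symplectic. *)
Lemma herm_pullback Z Z' (P : 'M[C]_n) (M : 'M[int]_(n + n)) :
    siegel Z -> siegel Z' -> symplectic_int M ->
    P *m period Z = period Z' *m intmxC R M ->
  P^T *m herm Z' *m cjmx P = herm Z.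
Proof.
move=> sZ sZ' M_sp PM; apply: subr0_eq; apply: (period_sesqui_eq0 sZ).
rewrite mulmxBr mulmxBl ImM_add ImM_opp Im_period // !mulmxA -trmx_mul -!mulmxA -cjmxM PM.
rewrite cjmxM cjmx_int -realmxC_int trmx_mul -realmxC_tr.
rewrite -[_ *m _ *m _]mulmxA [herm Z' *m _]mulmxA [_^T *m (_ *m _)]mulmxA mulmxA.
rewrite [_^T *m (_ *m _)]mulmxA.
rewrite ImM_sandwich Im_period // -intmxR_J -intmxR_tr -!intmxRM M_sp.
exact: subrr.
Qed.

(** Two signs cancel: conjugating the period form replaces [J] by [- J], and [E] reverses [J] again.
    The conjugated pullback thus has the same imaginary part on periods as [herm Z], which
    determines it. *)
Lemma herm_pullback_anti Z (K : 'M[C]_n) (E : 'M[int]_(n + n)) :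
    siegel Z -> E^T *m Jmx int n *m E = - Jmx int n ->
    K *m cjmx (period Z) = period Z *m intmxC R E ->
  K^T *m herm Z *m cjmx K = herm Z.
Proof.
move=> sZ E_sp KE; apply: (can_inj (@cjmxK R n n)); apply: subr0_eq.
have KE' : cjmx K *m period Z = cjmx (period Z) *m intmxC R E.
  by rewrite -[period Z in LHS]cjmxK -cjmxM KE cjmxM cjmx_int.
have J_cj : (cjmx (period Z))^T *m herm Z *m period Z
        = cjmx ((period Z)^T *m herm Z *m cjmx (period Z)).
  by rewrite !cjmxM cjmxK herm_cj cjmx_tr.
apply: (period_sesqui_eq0 sZ); rewrite !cjmxM cjmxK herm_cj cjmx_tr.
rewrite mulmxBr mulmxBl ImM_add ImM_opp Im_period // !mulmxA -trmx_mul -!mulmxA KE KE'.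
rewrite -realmxC_int trmx_mul -realmxC_tr.
rewrite -[_ *m _ *m _]mulmxA [herm Z *m _]mulmxA [_^T *m (_ *m _)]mulmxA mulmxA.
rewrite [_^T *m (_ *m _)]mulmxA J_cj ImM_sandwich ImM_cj Im_period //.
rewrite mulmxN mulNmx -intmxR_J -intmxR_tr -!intmxRM E_sp.
by apply/matrixP => i j; rewrite !mxE rmorphN opprK subrr.
Qed.

(** In lattice coordinates the real part of the polarization is a positive definite symmetric form,
    and [M] preserves it by [herm_pullback]; so [minkowski] applies. *)
Lemma period_rigid N Z (P : 'M[C]_n) (M : 'M[int]_(n + n)) :
    (4 <= N)%N -> siegel Z -> GammaN N M ->
    P *m period Z = period Z *m intmxC R M -> M = 1%:M /\ P = 1%:M.
Proof.
move=> N4 sZ [M_sp M1] PM.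
suff M_eq1 : M = 1%:M.
  by split=> //; apply: (@mul_period_inj Z); rewrite PM M_eq1 intmxC1 mul1mx mulmx1.
pose H := (period Z)^T *m herm Z *m cjmx (period Z).
have HM : realmxC (intmxR R M)^T *m H *m realmxC (intmxR R M) = H.
  rewrite /H -[in RHS](herm_pullback sZ sZ M_sp PM) !mulmxA -trmx_mul PM.
  rewrite -[in RHS]mulmxA -cjmxM PM cjmxM cjmx_int -intmxR_tr !realmxC_int.
  by rewrite intmxC_tr trmx_mul !mulmxA.
have H_tr : H^T = cjmx H.
  by rewrite /H !trmx_mul trmxK !cjmxM cjmxK herm_cj herm_tr // cjmx_tr mulmxA.
apply: (@minkowski R _ N (ReM H)) => //.
- move=> x x0.
  have := H_Z_gt0 (u := period Z *m realmxC x) sZ.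
  rewrite ltcE => /(_ _)/andP[|_].
    by apply: contra x0 => /eqP/(period_ker sZ)/eqP.
  suff -> : complex.Re (H_Z Z (period Z *m realmxC x) (period Z *m realmxC x)) =
            (x^T *m ReM H *m x) 0 0 by [].
  transitivity (ReM (realmxC x^T *m H *m realmxC x) 0 0).
    by rewrite [RHS]mxE /H_Z /H trmx_mul cjmxM cjmx_real realmxC_tr !mulmxA.
  by rewrite ReM_sandwich.
- by rewrite -ReM_tr H_tr ReM_cj.
- by rewrite -[in RHS]HM ReM_sandwich.
Qed.

End Periods.

(** * Integral symplectic matrices *)

Section IntegralSymplectic.
Variables (N n : nat).
Implicit Types g h A B : 'M[int]_(n + n).

Lemma J_sq : Jmx int n *m Jmx int n = - 1%:M.
Proof.
rewrite /Jmx mulmx_block !mul0mx !mulmx0 mul1mx mulmx1 !add0r addr0.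
by rewrite [in RHS]scalar_mx_block opp_block_mx oppr0.
Qed.

(** It relates the periods of [- cjmx Z] to the conjugate periods of [Z], and it is the matrix that
    level compatibility prescribes for a real structure modulo [N]. *)
Definition tau : 'M[int]_(n + n) := block_mx (- 1%:M) 0 0 1%:M.

Lemma tau_tr : tau^T = tau.
Proof. by rewrite /tau tr_block_mx linearN /= trmx1 !trmx0. Qed.

Lemma tauK : tau *m tau = 1%:M.
Proof.
by rewrite /tau mulmx_block mulmxN mulNmx opprK !mulmx1 !mulmx0 !mul0mx !addr0 add0r
  -scalar_mx_block.
Qed.

Lemma tau_J : tau *m Jmx int n *m tau = - Jmx int n.
Proof.
rewrite /tau /Jmx !mulmx_block opp_block_mx.
by rewrite !(mulmxN, mulNmx, mulmx1, mulmx0, mul0mx, mul1mx, addr0, add0r, oppr0, opprK).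
Qed.

Lemma symplectic_intM g h : symplectic_int g -> symplectic_int h -> symplectic_int (g *m h).
Proof.
move=> g_sp h_sp; rewrite /symplectic_int trmx_mul.
by rewrite -[RHS]h_sp -[in RHS]g_sp !mulmxA.
Qed.

Lemma symplectic_int_inv g : symplectic_int g ->
  exists h, [/\ h *m g = 1%:M, g *m h = 1%:M & symplectic_int h].
Proof.
move=> g_sp; pose h := - (Jmx int n *m g^T *m Jmx int n).
have hg : h *m g = 1%:M by rewrite /h mulNmx -!mulmxA (mulmxA g^T) g_sp J_sq opprK.
have gh := mulmx1C hg; exists h; split=> //.
by rewrite /symplectic_int -[in LHS]g_sp -!mulmxA gh mulmx1 !mulmxA -trmx_mul gh trmx1 mul1mx.
Qed.

(** The left inverse [- J g^T J] of [g] is also a right inverse; multiplying by [J] on the right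
    gives [g J g^T = J]. *)
Lemma symplectic_int_tr g : symplectic_int g -> symplectic_int g^T.
Proof.
move=> g_sp; rewrite /symplectic_int trmxK.
have : - (Jmx int n *m g^T *m Jmx int n) *m g = 1%:M.
  by rewrite mulNmx -!mulmxA (mulmxA g^T) g_sp J_sq opprK.
move/mulmx1C/(congr1 (mulmx^~ (Jmx int n))).
rewrite mulmxN mulNmx !mulmxA -[_ *m Jmx int n *m Jmx int n]mulmxA J_sq.
by rewrite mulmxN opprK mulmx1 mul1mx.
Qed.

(** Congruence modulo [N] carries its quotient matrix [D], since [D d] later gives the coordinates
    of the lattice vector by which two level points differ. *)
Definition cgr m p (A B : 'M[int]_(m, p)) := exists D, A = B + N%:Z *: D.

Lemma cgrP m p (A B : 'M[int]_(m, p)) : cgr A B <-> forall i j, (N%:Z %| A i j - B i j)%Z.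
Proof.
split=> [[D ->] i j|dvd]; first by rewrite !mxE addrAC subrr add0r dvdz_mulr.
exists (\matrix_(i, j) ((A i j - B i j) %/ N%:Z)%Z).
by apply/matrixP => i j; rewrite !mxE mulrC divzK // addrC subrK.
Qed.

Lemma cgr_refl m p (A : 'M[int]_(m, p)) : cgr A A.
Proof. by exists 0; rewrite scaler0 addr0. Qed.

Lemma cgr_sym m p (A B : 'M[int]_(m, p)) : cgr A B -> cgr B A.
Proof. by case=> D ->; exists (- D); rewrite scalerN addrK. Qed.

Lemma cgr_tr m p (A B : 'M[int]_(m, p)) : cgr A B -> cgr A^T B^T.
Proof. by case=> D ->; exists D^T; rewrite linearD linearZ. Qed.

Lemma cgrM m p q (A A' : 'M[int]_(m, p)) (B B' : 'M[int]_(p, q)) :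
  cgr A A' -> cgr B B' -> cgr (A *m B) (A' *m B').
Proof.
case=> D -> [E ->]; exists (A' *m E + D *m B' + N%:Z *: (D *m E)).
by rewrite mulmxDl !mulmxDr -!scalemxAl -!scalemxAr !scalerDr -!addrA.
Qed.

Lemma GammaNE g : GammaN N g <-> symplectic_int g /\ cgr g 1%:M.
Proof.
split=> -[g_sp g1]; split=> //; first by apply/cgrP => i j; rewrite mxE.
by move=> i j; move/cgrP: g1 => /(_ i j); rewrite mxE.
Qed.

Lemma GammaNM g h : GammaN N g -> GammaN N h -> GammaN N (g *m h).
Proof.
move=> /GammaNE[g_sp g1] /GammaNE[h_sp h1]; apply/GammaNE; split.
  exact: symplectic_intM.
by rewrite -[1%:M]mulmx1; apply: cgrM.
Qed.

Lemma GammaN_inv g : GammaN N g -> exists h, [/\ h *m g = 1%:M, g *m h = 1%:M & GammaN N h].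
Proof.
move=> /GammaNE[g_sp g1]; have [h [hg gh h_sp]] := symplectic_int_inv g_sp.
exists h; split=> //; apply/GammaNE; split=> //.
by rewrite -hg -[X in cgr X _]mulmx1; apply: cgrM (cgr_refl _) (cgr_sym g1).
Qed.

Lemma GammaN_tr g : GammaN N g -> GammaN N g^T.
Proof.
move=> /GammaNE[g_sp g1]; apply/GammaNE; split; first exact: symplectic_int_tr.
by rewrite -trmx1; apply: cgr_tr.
Qed.

End IntegralSymplectic.

(** * The symplectic action *)

Section Action.
Variables (R : realType) (n : nat).
Local Notation C := (R[i]).
Implicit Types (Z W K : 'M[C]_n) (g h : 'M[int]_(n + n)).

Definition denom g Z : 'M[C]_n := dlsubmx (intmxC R g) *m Z + drsubmx (intmxC R g).
Definition numer g Z : 'M[C]_n := ulsubmx (intmxC R g) *m Z + ursubmx (intmxC R g).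

Lemma mul_period_tr g Z : intmxC R g *m col_mx Z 1%:M = col_mx (numer g Z) (denom g Z).
Proof. by rewrite -[intmxC R g]submxK mul_block_col !mulmx1. Qed.

Lemma period_tr Z : Z^T = Z -> (period Z)^T = col_mx Z 1%:M.
Proof. by move=> Z_sym; rewrite tr_row_mx Z_sym trmx1. Qed.

Lemma mul_period_int g Z : Z^T = Z ->
  period Z *m intmxC R g^T = row_mx (numer g Z)^T (denom g Z)^T.
Proof.
move=> Z_sym; apply: trmx_inj.
by rewrite trmx_mul period_tr // intmxC_tr trmxK mul_period_tr tr_row_mx !trmxK.
Qed.

(** If [(C Z + D) v = 0], put [w = (Z v, v)]. Then [g w] has zero lower half, so [w^* J w = 0] by
    invariance; but this number is [- 2 i] times [v^* (Im Z) v], and positivity forces [v = 0]. *)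
Lemma denom_unit g Z : siegel Z -> symplectic_int g -> denom g Z \in unitmx.
Proof.
move=> [Z_sym Z_pos] g_sp; apply: unitmx_cker => v jv.
have [w wE] : exists w, w = col_mx Z 1%:M *m v by exists (col_mx Z 1%:M *m v).
have gw : intmxC R g *m w = col_mx (numer g Z *m v) 0.
  by rewrite wE mulmxA mul_period_tr mul_col_mx jv.
have JE : intmxC R (Jmx int n) = Jmx C n.
  by rewrite /intmxC /Jmx map_block_mx map_mx0 map_mxN map_mx1.
have : (cjmx w)^T *m Jmx C n *m w = 0.
  rewrite -JE -g_sp !intmxCM !mulmxA intmxC_tr -trmx_mul -[intmxC R g in X in X^T]cjmx_int.
  rewrite -cjmxM -mulmxA gw /cjmx map_col_mx map_mx0 tr_col_mx trmx0 JE /Jmx mul_row_block.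
  by rewrite !mulmx0 !mul0mx !add0r mul_row_col mulmx0 mul0mx !addr0.
rewrite wE mulmxA cjmxM trmx_mul /cjmx map_col_mx tr_col_mx -!/(cjmx _).
rewrite cjmx1 trmx1 -(cjmx_tr Z) Z_sym -[_ *m Jmx C n]mulmxA mul_row_block.
rewrite !mul1mx !mulmx0 mulmx1 add0r addr0 -[_ *m _ *m col_mx _ _]mulmxA mul_row_col.
rewrite mulNmx mul1mx mulmx1 addrC.
have -> : cjmx Z - Z = (- (2 * 'i%C)) *: realmxC (ImM Z).
  apply/matrixP => i j; rewrite !mxE -opprB subcJ mulNr; congr (- _).
  by rewrite mulrAC.
rewrite -scalemxAr -scalemxAl => /matrixP /(_ 0 0); rewrite !mxE => /eqP.
rewrite mulf_eq0 oppr_eq0 mulf_eq0 pnatr_eq0 /= => /orP[|/eqP q0].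
  by rewrite eq_complex /= oner_eq0 andbF.
apply/eqP/negPn/negP => v0.
have cv0 : cjmx v != 0.
  by apply: contra v0 => /eqP cv; rewrite -[v]cjmxK cv /cjmx map_mx0.
have := Re_sesqui_gt0 Z_pos cv0; rewrite cjmxK.
by rewrite [X in complex.Re X](_ : _ = 0) ?ltxx // mxE.
Qed.

(** This is the transpose of [g (Z; 1) = (W; 1) (C Z + D)], with [Z] and [W] symmetric. The
    right-hand blocks always agree; the left-hand ones say [A Z + B = W (C Z + D)]. *)
Lemma sp_actE g Z W : siegel Z -> symplectic_int g -> W^T = W ->
  sp_act (intmxC R g) Z = W <-> period Z *m intmxC R g^T = (denom g Z)^T *m period W.
Proof.
move=> sZ g_sp W_sym; have j_unit := denom_unit sZ g_sp; have [Z_sym _] := sZ.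
rewrite mul_period_int // mul_mx_row mulmx1 /sp_act -/(numer g Z) -/(denom g Z).
split=> [jW|/eq_row_mx[nj _]].
  by congr row_mx; rewrite -W_sym -trmx_mul -jW mulmxKV.
have := congr1 trmx nj; rewrite trmxK trmx_mul trmxK W_sym => ->.
exact: mulmxK.
Qed.

Lemma period_cjN Z : period (- cjmx Z) = cjmx (period Z) *m intmxC R (tau n).
Proof.
rewrite /period cjmx_row /tau /intmxC map_block_mx map_mx0 map_mxN !map_mx1 mul_row_block.
by rewrite !mulmx0 mulmxN !mulmx1 addr0 add0r cjmx1.
Qed.

(* In the basis of periods, [kappa_Z] is the integral matrix [g^T tau]. *)
Lemma sp_act_cjN g Z : siegel Z -> symplectic_int g ->
  sp_act (intmxC R g) Z = - cjmx Z <->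
  (denom g Z)^T *m cjmx (period Z) = period Z *m intmxC R (g^T *m tau n).
Proof.
move=> sZ g_sp; have [W_sym _] := siegel_cjN sZ.
apply: iff_trans (sp_actE sZ g_sp W_sym) _; rewrite intmxCM period_cjN !mulmxA.
split=> [->|->]; rewrite -mulmxA -intmxCM tauK intmxC1 mulmx1 //.
Qed.

Lemma kappa_ZE g Z x : siegel Z -> symplectic_int g -> sp_act (intmxC R g) Z = - cjmx Z ->
  kappa_Z g Z (period Z *m realmxC x) = period Z *m realmxC (intmxR R (g^T *m tau n) *m x).
Proof.
move=> sZ g_sp /(sp_act_cjN sZ g_sp) gZ.
by rewrite /kappa_Z -/(denom g Z) cjmxM mulmxA gZ cjmx_real realmxCM realmxC_int mulmxA.
Qed.

(** * Rigidity for antilinear maps and uniqueness of [gamma] *)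

Section Level.
Variable N : nat.
Hypothesis N_ge4 : (4 <= N)%N.

(** The composite of two antilinear maps is linear, with complex matrix [K *m cjmx K'] and integral
    matrix [E *m E'], so [period_rigid] applies to it. *)
Lemma anti_rigid Z K K' (E E' : 'M[int]_(n + n)) : siegel Z ->
    GammaN N (E *m E') ->
    K *m cjmx (period Z) = period Z *m intmxC R E ->
    K' *m cjmx (period Z) = period Z *m intmxC R E' ->
  E *m E' = 1%:M /\ K *m cjmx K' = 1%:M.
Proof.
move=> sZ EE' KE KE'; apply: (period_rigid N_ge4 sZ EE').
rewrite -mulmxA -{1}[period Z]cjmxK -[cjmx K' *m _]cjmxM KE' cjmxM cjmx_int mulmxA KE.
by rewrite -mulmxA -intmxCM.
Qed.

Lemma GammaN_tau g : GammaN N g -> GammaN N (tau n *m g *m tau n).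
Proof.
move=> /GammaNE[g_sp g1]; apply/GammaNE; split.
  rewrite /symplectic_int !trmx_mul tau_tr.
  have -> : tau n *m (g^T *m tau n) *m Jmx int n *m (tau n *m g *m tau n)
          = tau n *m (g^T *m (tau n *m Jmx int n *m tau n) *m g) *m tau n.
    by rewrite !mulmxA.
  by rewrite tau_J mulmxN mulNmx g_sp mulmxN mulNmx tau_J opprK.
have : cgr N (tau n *m g *m tau n) (tau n *m 1%:M *m tau n).
  by apply: cgrM (cgr_refl _ _); apply: cgrM => //; apply: cgr_refl.
by rewrite mulmx1 tauK.
Qed.

Lemma GammaN_anti_comp g h : GammaN N g -> GammaN N h ->
  GammaN N ((g^T *m tau n) *m (h^T *m tau n)).
Proof.
move=> /GammaN_tr gG /GammaN_tr hG; rewrite -mulmxA [tau n *m (_ *m _)]mulmxA.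
exact: GammaNM gG (GammaN_tau hG).
Qed.

(** For [E = g^T tau] and [E' = g'^T tau], rigidity gives [E E = 1] and [E E' = 1], hence
    [E = E']. *)
Lemma conj_act_inj Z g g' : siegel Z -> GammaN N g -> GammaN N g' ->
  sp_act (intmxC R g) Z = - cjmx Z -> sp_act (intmxC R g') Z = - cjmx Z -> g = g'.
Proof.
move=> sZ gG g'G /(sp_act_cjN sZ (proj1 gG)) gZ /(sp_act_cjN sZ (proj1 g'G)) g'Z.
have [EE _] := anti_rigid sZ (GammaN_anti_comp gG gG) gZ gZ.
have [EE' _] := anti_rigid sZ (GammaN_anti_comp gG g'G) gZ g'Z.
have {EE'} : g^T *m tau n = g'^T *m tau n.
  by rewrite -[LHS]mulmx1 -EE' mulmxA EE mul1mx.
move/(congr1 (mulmx^~ (tau n))); rewrite -!mulmxA tauK !mulmx1; exact: trmx_inj.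
Qed.

End Level.

End Action.

(** * The standard varieties *)

Section Families.
Variables (R : realType) (n : nat).
Local Notation C := (R[i]).

Definition fam_mx m (w : 'I_m -> 'cV[C]_n) : 'M[C]_(n, m) := \matrix_(i, j) w j i 0.

Lemma col_fam m (w : 'I_m -> 'cV[C]_n) k : col k (fam_mx w) = w k.
Proof. by apply/matrixP => i j; rewrite ord1 !mxE. Qed.

Lemma fam_cat (u v : 'I_n -> 'cV[C]_n) : fam_mx (cat_fam u v) = row_mx (fam_mx u) (fam_mx v).
Proof.
apply/matrixP => i k; rewrite !mxE /cat_fam.
by case: splitP => j _; rewrite mxE.
Qed.

Lemma fam_realE m (w : 'I_m -> 'cV[C]_n) (c : 'I_m -> R) :
  \sum_i realC (c i) *: w i = fam_mx w *m realmxC (\col_i c i).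
Proof.
apply/matrixP => i j; rewrite ord1 summxE [RHS]mxE; apply: eq_bigr => k _.
by rewrite !mxE mulrC.
Qed.

Lemma fam_intE m (w : 'I_m -> 'cV[C]_n) (c : 'I_m -> int) :
  \sum_i intC R (c i) *: w i = fam_mx w *m intmxC R (\col_i c i).
Proof.
apply/matrixP => i j; rewrite ord1 summxE [RHS]mxE; apply: eq_bigr => k _.
by rewrite !mxE mulrC.
Qed.

Lemma Z_spanE m (w : 'I_m -> 'cV[C]_n) x :
  Z_span w x <-> exists k : 'cV[int]_m, x = fam_mx w *m intmxC R k.
Proof.
split=> [[c ->]|[k ->]]; first by exists (\col_i c i); rewrite fam_intE.
exists (fun i => k i 0); rewrite fam_intE; congr (_ *m intmxC R _).
by apply/matrixP => i j; rewrite ord1 mxE.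
Qed.

Lemma sesqui_col m p (X : 'M[C]_(n, m)) (Y : 'M[C]_(n, p)) (G : 'M[C]_n) k l :
  ((col k X)^T *m G *m cjmx (col l Y)) 0 0 = (X^T *m G *m cjmx Y) k l.
Proof.
rewrite tr_col -row_mul /cjmx map_col -/(cjmx _).
by rewrite [LHS]mxE [RHS]mxE; apply: eq_bigr => s _; rewrite [X in X * _]mxE [X in _ * X]mxE.
Qed.

End Families.

(** * Polarization, real structure and level structure of [A_Z] *)

Section StandardVariety.
Variables (R : realType) (N n : nat).
Local Notation C := (R[i]).
Hypothesis N_ge4 : (4 <= N)%N.
Implicit Types (Z K : 'M[C]_n) (g : 'M[int]_(n + n)).

Definition std_u Z (i : 'I_n) : 'cV[C]_n := col (lshift n i) (period Z).
Definition std_v Z (j : 'I_n) : 'cV[C]_n := col (rshift n j) (period Z).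

Lemma fam_std Z : fam_mx (cat_fam (std_u Z) (std_v Z)) = period Z.
Proof.
rewrite fam_cat; congr row_mx; apply/matrixP => i j; rewrite !mxE.
  by rewrite (unsplitK (inl _ j)).
by rewrite (unsplitK (inr _ j)) mxE.
Qed.

Lemma std_uE Z i : std_u Z i = period Z *m intmxC R (delta_mx (lshift n i) 0).
Proof. by rewrite /std_u colE /intmxC map_delta_mx. Qed.

Lemma std_vE Z i : std_v Z i = period Z *m intmxC R (delta_mx (rshift n i) 0).
Proof. by rewrite /std_v colE /intmxC map_delta_mx. Qed.

Lemma std_symp_basis Z : siegel Z -> symp_basis (L_Z Z) (H_Z Z) (std_u Z) (std_v Z).
Proof.
move=> sZ; split.
- move=> x; apply: iff_trans (L_ZE _ _) _; apply: iff_sym.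
  by apply: iff_trans (Z_spanE _ _) _; rewrite fam_std.
- move=> c; rewrite fam_intE fam_std -realmxC_int => /(period_ker sZ).
  move=> /matrixP c0 i; have := c0 i 0; rewrite !mxE => /eqP.
  by rewrite intr_eq0 => /eqP.
have QE k l : Qform (H_Z Z) (col k (period Z)) (col l (period Z)) = Jmx R n k l.
  rewrite -(Im_period sZ) [RHS]mxE; congr (complex.Im _).
  exact: sesqui_col.
move=> i j; rewrite !QE /Jmx.
by rewrite block_mxEul block_mxEdr block_mxEur block_mxEdl !mxE.
Qed.

Lemma pU_std g Z i : pU (A_Z N g Z) i = Ninv R N *: std_u Z i.
Proof.
rewrite /= /F_Z /e_vec /std_u /Ninv colKl; apply/matrixP => k j.
have -> : realmxC (0 : 'cV[R]_n) = 0 by rewrite /realmxC map_mx0.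
rewrite addr0 /realmxC map_mxZ map_delta_mx -scalemxAr -colE !mxE; congr (_ * _).
by rewrite fmorphV rmorph_nat.
Qed.

Lemma pV_std g Z i : pV (A_Z N g Z) i = Ninv R N *: std_v Z i.
Proof.
rewrite /= /F_Z /e_vec /std_v /Ninv colKr; apply/matrixP => k j.
have -> : realmxC (0 : 'cV[R]_n) = 0 by rewrite /realmxC map_mx0.
rewrite mulmx0 add0r /realmxC map_mxZ map_delta_mx !mxE !ord1 eqxx andbT; congr (_ * _).
by rewrite fmorphV rmorph_nat.
Qed.

Lemma L_Z0 Z : L_Z Z 0.
Proof. by apply/L_ZE; exists 0; rewrite /intmxC map_mx0 mulmx0. Qed.

Lemma std_level_lift g Z : siegel Z -> level_lift N (A_Z N g Z) (std_u Z) (std_v Z).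
Proof.
move=> sZ; split; first exact: std_symp_basis.
by move=> i; rewrite pU_std pV_std !subrr; split; apply: L_Z0.
Qed.

Lemma is_lattice_L_Z Z : siegel Z -> is_lattice (L_Z Z).
Proof.
move=> sZ; exists (cat_fam (std_u Z) (std_v Z)); split.
  move=> c; rewrite fam_realE fam_std => /(period_ker sZ)/matrixP c0 i.
  by have := c0 i 0; rewrite !mxE.
by case: (std_symp_basis sZ).
Qed.

Lemma H_Z_cj Z u v : conjc (H_Z Z u v) = H_Z Z (cjmx u) (cjmx v).
Proof.
transitivity (cjmx (u^T *m herm Z *m cjmx v) 0 0); first by rewrite [RHS]mxE.
by rewrite !cjmxM herm_cj cjmx_tr.
Qed.

Lemma H_Z_herm Z : siegel Z -> posdef_hermitian (H_Z Z).
Proof.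
move=> sZ; split.
- by move=> u u' v; rewrite /H_Z linearD /= !mulmxDl mxE.
- by move=> a u v; rewrite /H_Z linearZ /= -!scalemxAl mxE.
- move=> u v; rewrite H_Z_cj /H_Z cjmxK -/(herm Z).
  transitivity ((v^T *m herm Z *m cjmx u)^T 0 0); first by rewrite [RHS]mxE.
  by rewrite !trmx_mul trmxK herm_tr // mulmxA.
- by move=> u; apply: H_Z_gt0.
Qed.

Lemma anti_symplectic g : symplectic_int g ->
  (g^T *m tau n)^T *m Jmx int n *m (g^T *m tau n) = - Jmx int n.
Proof.
move/symplectic_int_tr=> g_sp; rewrite trmx_mul tau_tr.
have -> : tau n *m g^T^T *m Jmx int n *m (g^T *m tau n)
        = tau n *m (g^T^T *m Jmx int n *m g^T) *m tau n by rewrite !mulmxA.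
by rewrite g_sp tau_J.
Qed.

(** Integrality of [g^T tau] sends the lattice into itself, and rigidity makes the square of
    [kappa_Z] trivial, so the image is the whole lattice. The pulled-back form is the conjugate of
    [H_Z], which changes the sign of [Q]. *)
Lemma kappa_Z_real_structure g Z : siegel Z -> GammaN N g ->
  sp_act (intmxC R g) Z = - cjmx Z -> real_structure (L_Z Z) (H_Z Z) (kappa_Z g Z).
Proof.
move=> sZ gG gZ; have [g_sp _] := gG.
have KE := (sp_act_cjN sZ g_sp).1 gZ.
have [_ KK] := anti_rigid N_ge4 sZ (GammaN_anti_comp gG gG) KE KE.
have kK : involutive (kappa_Z g Z).
  by move=> u; rewrite /kappa_Z -/(denom g Z) cjmxM cjmxK mulmxA KK mul1mx.
have kL u : L_Z Z u -> L_Z Z (kappa_Z g Z u).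
  move=> /L_ZE[k ->]; apply/L_ZE; exists ((g^T *m tau n) *m k).
  by rewrite -realmxC_int kappa_ZE // -intmxRM realmxC_int.
split=> //.
- by move=> u v; rewrite /kappa_Z cjmxD mulmxDr.
- by move=> a u; rewrite /kappa_Z cjmxZ scalemxAr.
- by move=> x; split=> [xL|[u [uL ->]]]; [exists (kappa_Z g Z x); rewrite kK; auto|auto].
move=> u v.
have -> : Qform (H_Z Z) (kappa_Z g Z u) (kappa_Z g Z v) = complex.Im (conjc (H_Z Z u v)).
  congr (complex.Im _); rewrite H_Z_cj /H_Z /kappa_Z -/(denom g Z) -/(herm Z).
  rewrite -[in RHS](herm_pullback_anti sZ (anti_symplectic g_sp) KE).
  by rewrite trmx_mul !cjmxM !mulmxA.
by rewrite /Qform; case: (H_Z Z u v).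
Qed.

Lemma Ninv_mul : Ninv R N * N%:R = 1.
Proof. by rewrite mulVf // pnatr_eq0 -lt0n (leq_trans _ N_ge4). Qed.

Lemma tau_lshift i : tau n *m delta_mx (lshift n i) 0 = - delta_mx (lshift n i) 0 :> 'cV_(n + n).
Proof.
rewrite -[in RHS](mul1mx (delta_mx _ _)) -!colE scalar_mx_block /tau !block_mxEh !colKl.
by apply/matrixP => k j; rewrite !mxE; case: split => l; rewrite !mxE ?oppr0.
Qed.

Lemma tau_rshift i : tau n *m delta_mx (rshift n i) 0 = delta_mx (rshift n i) 0 :> 'cV_(n + n).
Proof.
rewrite -[RHS](mul1mx (delta_mx _ _)) -!colE scalar_mx_block /tau !block_mxEh !colKr.
by apply/matrixP => k j; rewrite !mxE; case: split => l; rewrite !mxE.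
Qed.

Lemma A_Z_level_compatible g Z : siegel Z -> GammaN N g ->
  sp_act (intmxC R g) Z = - cjmx Z -> level_compatible N (A_Z N g Z).
Proof.
move=> sZ gG gZ; have [g_sp _] := gG.
have [D gD] : cgr N (g^T *m tau n) (tau n).
  have /GammaNE[_ g1] := GammaN_tr gG.
  by rewrite -[X in cgr _ _ X]mul1mx; apply: cgrM (cgr_refl _ _).
exists (std_u Z), (std_v Z); split; first exact: std_level_lift.
(* With [g^T tau = tau + N D], the factor [1 / N] turns the error term into the lattice vector of
   coordinates [D d]. *)
have kE d : kappa_Z g Z (Ninv R N *: (period Z *m intmxC R d)) =
    Ninv R N *: (period Z *m intmxC R (tau n *m d)) + period Z *m intmxC R (D *m d).
  rewrite -[X in kappa_Z g Z X]scale1r /kappa_Z -/(denom g Z) scale1r cjmxZ cjmxM cjmx_int.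
  rewrite -scalemxAr mulmxA ((sp_act_cjN sZ g_sp).1 gZ) gD -mulmxA -intmxCM mulmxDl.
  rewrite /intmxC map_mxD -!/(intmxC R _) mulmxDr scalerDr; congr (_ + _).
    by rewrite /Ninv fmorphV rmorph_nat.
  rewrite -scalemxAl /intmxC map_mxZ -scalemxAr scalerA.
  by rewrite /Ninv fmorphV rmorph_nat Ninv_mul scale1r.
move=> i /=; rewrite std_uE std_vE !kE tau_lshift tau_rshift.
split; apply/L_ZE; [exists (D *m delta_mx (lshift n i) 0)|exists (D *m delta_mx (rshift n i) 0)].
  rewrite [intmxC R (- _)]map_mxN mulmxN scalerN -/(intmxC R _).
  by rewrite addrAC addNr add0r.
by rewrite addrAC subrr add0r.
Qed.

Lemma A_Z_real_ppav g Z : siegel Z -> GammaN N g ->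
  sp_act (intmxC R g) Z = - cjmx Z -> real_ppav_level N (A_Z N g Z).
Proof.
move=> sZ gG gZ; split.
- split; [exact: is_lattice_L_Z|exact: H_Z_herm|].
  by exists (std_u Z), (std_v Z); apply: std_symp_basis.
- exact: kappa_Z_real_structure.
- by exists (std_u Z), (std_v Z); apply: std_level_lift.
- exact: A_Z_level_compatible.
Qed.

End StandardVariety.

(** * Isomorphisms and orbits *)

Section Isomorphisms.
Variables (R : realType) (N n : nat).
Local Notation C := (R[i]).
Hypothesis N_ge4 : (4 <= N)%N.
Implicit Types (Z K P : 'M[C]_n) (g M : 'M[int]_(n + n)).

(** The right-hand block forces [K] to be [(denom g Z)^T], which reduces to [sp_actE]. *)
Lemma sp_act_period g Z Z' K : siegel Z -> siegel Z' -> symplectic_int g ->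
  period Z *m intmxC R g^T = K *m period Z' -> sp_act (intmxC R g) Z = Z'.
Proof.
move=> sZ [Z'_sym _] g_sp gK; apply/sp_actE => //; rewrite gK; congr (_ *m _).
have [Z_sym _] := sZ; move: gK.
by rewrite mul_period_int // mul_mx_row mulmx1 => /eq_row_mx[].
Qed.

(** The right half of [period Z *m M'] is a right inverse of [P], because [period Z'] has right half
    1. *)
Lemma period_iso_unit Z Z' P M M' : M *m M' = 1%:M ->
  P *m period Z = period Z' *m intmxC R M -> P \in unitmx.
Proof.
move=> MM' PM; suff /mulmx1_unit[] : P *m rsubmx (period Z *m intmxC R M') = 1%:M by [].
by rewrite mulmx_rsub mulmxA PM -mulmxA -intmxCM MM' intmxC1 mulmx1 row_mxKr.
Qed.

Lemma period_level P Z Z' M D (d : 'cV_(n + n)) : M = 1%:M + N%:Z *: D ->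
  P *m period Z = period Z' *m intmxC R M ->
  P *m (Ninv R N *: (period Z *m intmxC R d)) - Ninv R N *: (period Z' *m intmxC R d)
    = period Z' *m intmxC R (D *m d).
Proof.
move=> MD PM; rewrite -scalemxAr mulmxA PM MD -mulmxA -intmxCM mulmxDl mul1mx.
rewrite /intmxC map_mxD -!/(intmxC R _) mulmxDr scalerDr addrAC subrr add0r.
by rewrite -scalemxAl /intmxC map_mxZ -scalemxAr scalerA Ninv_mul // scale1r.
Qed.

Lemma pav_iso_period Z Z' g g' P M :
    siegel Z -> GammaN N g -> sp_act (intmxC R g) Z = - cjmx Z ->
    siegel Z' -> GammaN N g' -> sp_act (intmxC R g') Z' = - cjmx Z' ->
    GammaN N M -> P *m period Z = period Z' *m intmxC R M ->
  pav_iso N (A_Z N g Z) (A_Z N g' Z') P.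
Proof.
move=> sZ gG gZ sZ' g'G g'Z' MG PM; have [M_sp _] := MG.
have [M' [M'M MM' M'G]] := GammaN_inv MG.
have P_unit := period_iso_unit MM' PM.
have M'P : period Z *m intmxC R M' = invmx P *m period Z'.
  by rewrite -[LHS](mulKmx P_unit) [P *m _]mulmxA PM -mulmxA -intmxCM MM' intmxC1 mulmx1.
split=> //=.
- move=> x; split=> [/L_ZE[k ->]|[u [/L_ZE[k ->] ->]]].
    exists (period Z *m intmxC R (M' *m k)); split; first by apply/L_ZE; exists (M' *m k).
    by rewrite mulmxA PM -mulmxA -intmxCM mulmxA MM' mul1mx.
  by apply/L_ZE; exists (M *m k); rewrite mulmxA PM -mulmxA -intmxCM.
- move=> u v; rewrite /H_Z -!/(herm _) -(herm_pullback sZ sZ' M_sp PM).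
  by rewrite trmx_mul cjmxM !mulmxA.
- have KE := (sp_act_cjN sZ (proj1 gG)).1 gZ.
  have KE' := (sp_act_cjN sZ' (proj1 g'G)).1 g'Z'.
  have [_ KK'] := anti_rigid N_ge4 sZ' (GammaN_anti_comp g'G g'G) KE' KE'.
  (* [K1] is the matrix of [kappa_Z] transported along [P]. By rigidity both [K1] and the matrix of
     the target's real structure are inverse to the conjugate of the latter, so they coincide. *)
  pose K1 := P *m (denom g Z)^T *m cjmx (invmx P).
  have KE1 : K1 *m cjmx (period Z') = period Z' *m intmxC R (M *m (g^T *m tau n) *m M').
    rewrite /K1 -mulmxA -cjmxM -M'P cjmxM cjmx_int !mulmxA -[P *m _ *m _]mulmxA KE.
    by rewrite mulmxA PM !intmxCM !mulmxA.
  have G1 : GammaN N (M *m (g^T *m tau n) *m M' *m (g'^T *m tau n)).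
    have -> : M *m (g^T *m tau n) *m M' *m (g'^T *m tau n)
            = (M *m g^T) *m (tau n *m (M' *m g'^T) *m tau n) by rewrite !mulmxA.
    apply: GammaNM; first by apply: GammaNM => //; apply: GammaN_tr.
    by apply: GammaN_tau; apply: GammaNM => //; apply: GammaN_tr.
  have [_ K1K'] := anti_rigid N_ge4 sZ' G1 KE1 KE'.
  have K1E : K1 = (denom g' Z')^T.
    by rewrite -[LHS]mulmx1 -(mulmx1C KK') mulmxA K1K' mul1mx.
  by move=> x; rewrite /kappa_Z -!/(denom _ _) -K1E /K1 cjmxM !mulmxA.
exists (std_u Z), (std_v Z), (std_u Z'), (std_v Z').
split; try exact: std_level_lift.
have /GammaNE[_ [D MD]] := MG.
move=> i; rewrite !std_uE !std_vE !(period_level _ MD PM).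
by split; apply/L_ZE; eexists.
Qed.

Lemma L_ZD Z u v : L_Z Z u -> L_Z Z v -> L_Z Z (u + v).
Proof.
move=> /L_ZE[k ->] /L_ZE[l ->]; apply/L_ZE; exists (k + l).
by rewrite /intmxC map_mxD mulmxDr.
Qed.

Lemma L_ZN Z u : L_Z Z u -> L_Z Z (- u).
Proof.
by move=> /L_ZE[k ->]; apply/L_ZE; exists (- k); rewrite /intmxC map_mxN mulmxN.
Qed.

Lemma sesqui_inj (A B : 'M[C]_n) :
  (forall u v : 'cV[C]_n, (u^T *m A *m cjmx v) 0 0 = (u^T *m B *m cjmx v) 0 0) -> A = B.
Proof.
move=> AB; apply/matrixP => i j; have := AB (delta_mx i 0) (delta_mx j 0).
by rewrite /cjmx map_delta_mx trmx_delta -!rowE -!colE !mxE.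
Qed.

(** Converse of [herm_pullback]: both period forms have imaginary part [J], so comparing them gives
    [M^T J M = J]. *)
Lemma symplectic_period Z Z' P M : siegel Z -> siegel Z' ->
  P^T *m herm Z' *m cjmx P = herm Z -> P *m period Z = period Z' *m intmxC R M ->
  symplectic_int M.
Proof.
move=> sZ sZ' HP PM; apply: (@intmxR_inj R).
rewrite !intmxRM intmxR_J -{1}(Im_period sZ') -ImM_sandwich -(Im_period sZ) -HP.
congr ImM; transitivity ((P *m period Z)^T *m herm Z' *m cjmx (P *m period Z)).
  by rewrite PM cjmxM cjmx_int trmx_mul !realmxC_int intmxC_tr !mulmxA.
by rewrite cjmxM trmx_mul !mulmxA.
Qed.

Lemma eq_cols (T : Type) (m p : nat) (A B : 'M[T]_(m, p)) :
  (forall k, col k A = col k B) -> A = B.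
Proof. by move=> AB; apply/matrixP => i k; have /matrixP/(_ i 0) := AB k; rewrite !mxE. Qed.

Lemma col_mulmx (T : pzRingType) (m p q : nat) (A : 'M[T]_(m, p)) (B : 'M[T]_(p, q)) k :
  col k (A *m B) = A *m col k B.
Proof. by rewrite !colE mulmxA. Qed.

(** Finite choice, used to build the integral matrix of a map from the coordinates of the image of
    each basis vector. *)
Lemma int_cols_exist (m p : nat) (Q : 'I_p -> 'cV[int]_m -> Prop) :
  (forall k, exists c, Q k c) -> exists M : 'M[int]_(m, p), forall k, Q k (col k M).
Proof.
case/fin_all_exists=> f fQ; exists (\matrix_(i, j) f j i 0) => k.
by have -> : col k (\matrix_(i, j) f j i 0) = f k; last exact: fQ;
  apply/matrixP => i j; rewrite ord1 !mxE.
Qed.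

Lemma pav_iso_orbit Z Z' g g' P : siegel Z -> siegel Z' ->
  pav_iso N (A_Z N g Z) (A_Z N g' Z') P ->
  exists h, GammaN N h /\ Z' = sp_act (intmxC R h) Z.
Proof.
move=> sZ sZ' [PL PH P_unit _ [u [v [u' [v' [[_ luv] [_ luv'] Puv]]]]]].
have PL' x : L_Z Z x -> L_Z Z' (P *m x) by move=> xL; apply/PL; exists x.
have [M PM] : exists M, P *m period Z = period Z' *m intmxC R M.
  have /int_cols_exist[M ME] (k : 'I_(n + n)) :
      exists c, P *m col k (period Z) = period Z' *m intmxC R c.
    apply/L_ZE/PL'/L_ZE; exists (delta_mx k 0).
    by rewrite /intmxC map_delta_mx -colE.
  exists M; apply: eq_cols => k; rewrite !col_mulmx ME; congr (_ *m _).
  by rewrite /intmxC map_col.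
have HP : P^T *m herm Z' *m cjmx P = herm Z.
  by apply: sesqui_inj => x y; have := PH x y; rewrite /= /H_Z trmx_mul cjmxM !mulmxA.
have M_sp := symplectic_period sZ sZ' HP PM.
(* The isomorphism compares some lifts [y], [y']; these differ from the standard level points [x],
   [x'] by lattice vectors, so the congruence passes to the standard points. *)
have level (x y x' y' : 'cV[C]_n) : L_Z Z (x - y) -> L_Z Z' (x' - y') ->
    L_Z Z' (P *m y - y') -> L_Z Z' (P *m x - x').
  move=> xy xy' Pyy'; have -> : P *m x - x' = P *m (x - y) + (P *m y - y') + - (x' - y').
    by rewrite mulmxBr opprB !addrA !subrK.
  by apply: L_ZD (L_ZN xy'); apply: L_ZD => //; apply: PL'.
have M1 : cgr N M 1%:M.
  have /int_cols_exist[D DE] (k : 'I_(n + n)) :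
      exists d, col k M = delta_mx k 0 + N%:Z *: d.
    have [d dE] : exists d, P *m (Ninv R N *: col k (period Z)) - Ninv R N *: col k (period Z')
        = period Z' *m intmxC R d.
      apply/L_ZE; case: (splitP k) => i ki.
        have -> : k = lshift n i by apply: val_inj.
        apply: level (Puv i).1; first by have := (luv i).1; rewrite pU_std.
        by have := (luv' i).1; rewrite pU_std.
      have -> : k = rshift n i by apply: val_inj.
      apply: level (Puv i).2; first by have := (luv i).2; rewrite pV_std.
      by have := (luv' i).2; rewrite pV_std.
    exists d; apply: (period_int_inj sZ').
    (* Multiplying the congruence of level points by [N] turns it into a congruence modulo [N]
       between lattice coordinates. *)
    have := congr1 ( *:%R (N%:R : C)) dE.
    rewrite scalerBr -scalemxAr !scalerA mulrC Ninv_mul // !scale1r -col_mulmx PM.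
    rewrite col_mulmx /intmxC map_col -/(intmxC R _) => /eqP; rewrite subr_eq addrC => /eqP ->.
    rewrite map_mxD map_mxZ map_delta_mx -/(intmxC R _) mulmxDr -colE; congr (_ + _).
    by rewrite -scalemxAr.
  exists D; apply: eq_cols => k; rewrite DE; apply/matrixP => i j.
  by rewrite ord1 !mxE eqxx andbT.
have MG : GammaN N M by apply/GammaNE.
have [M' [M'M MM' M'G]] := GammaN_inv MG.
(* From [P Pi = Pi' M] follows [Pi M' = P^-1 Pi'], the relation of [sp_act_period] for the transpose
   of [M']. *)
exists M'^T; split; first exact: GammaN_tr.
symmetry; apply: (@sp_act_period _ _ _ (invmx P)) => //; first by case: (GammaN_tr M'G).
by rewrite trmxK -[LHS](mulKmx P_unit) [P *m _]mulmxA PM -mulmxA -intmxCM MM' intmxC1 mulmx1.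
Qed.

Lemma orbit_pav_iso Z Z' g g' h :
    siegel Z -> GammaN N g -> sp_act (intmxC R g) Z = - cjmx Z ->
    siegel Z' -> GammaN N g' -> sp_act (intmxC R g') Z' = - cjmx Z' ->
    GammaN N h -> Z' = sp_act (intmxC R h) Z ->
  pav_isomorphic N (A_Z N g Z) (A_Z N g' Z').
Proof.
move=> sZ gG gZ sZ' g'G g'Z' hG; have [h_sp _] := hG.
move/esym/(sp_actE sZ h_sp (proj1 sZ')) => hE.
have [M [_ hM MG]] := GammaN_inv (GammaN_tr hG).
have j_unit : (denom h Z)^T \in unitmx by rewrite unitmx_tr denom_unit.
(* The action equation reads [Pi h^T = (C Z + D)^T Pi']; inverting both factors gives [P Pi = Pi' M]
   with [M] inverse to [h^T]. *)
exists (invmx (denom h Z)^T); apply: pav_iso_period (MG) _ => //.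
by rewrite -[RHS](mulKmx j_unit) [_^T *m _]mulmxA -hE -mulmxA -intmxCM hM intmxC1 mulmx1.
Qed.

End Isomorphisms.

(** * Uniformization *)

Section Uniformization.
Variables (R : realType) (n : nat).
Local Notation C := (R[i]).

Lemma cV_sum_delta (x : 'cV[C]_n) : x = \sum_i x i 0 *: delta_mx i 0.
Proof.
apply/matrixP => i j; rewrite ord1 summxE (bigD1 i) //= !mxE !eqxx mulr1.
rewrite big1 ?addr0 // => k ki; rewrite !mxE eq_sym (negPf ki) mulr0 //.
Qed.

Lemma antilinear_mx (k : 'cV[C]_n -> 'cV[C]_n) :
    (forall u v, k (u + v) = k u + k v) -> (forall (a : C) u, k (a *: u) = conjc a *: k u) ->
  exists K : 'M[C]_n, forall x, k x = K *m cjmx x.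
Proof.
move=> kD kZ; exists (fam_mx (fun i => k (delta_mx i 0))) => x.
have k0 : k 0 = 0 by have := kZ 0 0; rewrite conjc0 !scale0r.
rewrite {1}[x]cV_sum_delta (big_morph k kD k0).
apply/matrixP => i j; rewrite ord1 summxE [RHS]mxE; apply: eq_bigr => l _.
by rewrite kZ !mxE mulrC.
Qed.

Lemma hermitian_mx (H : 'cV[C]_n -> 'cV[C]_n -> C) : posdef_hermitian H ->
  exists2 G : 'M[C]_n, G^T = cjmx G & forall x y, H x y = (x^T *m G *m cjmx y) 0 0.
Proof.
case=> HD HZ HC _; pose G : 'M[C]_n := \matrix_(i, j) H (delta_mx i 0) (delta_mx j 0).
exists G; first by apply/matrixP => i j; rewrite !mxE HC.
have H0 y : H 0 y = 0 by have := HZ 0 0 y; rewrite scale0r mul0r.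
have HDr x y y' : H x (y + y') = H x y + H x y' by rewrite HC HD rmorphD /= -!HC.
have H0r x : H x 0 = 0 by rewrite HC H0 rmorph0.
have HZr a x y : H x (a *: y) = conjc a * H x y by rewrite HC HZ rmorphM /= -HC.
move=> x y; rewrite {1}[x]cV_sum_delta (big_morph (H^~ y) (fun u v => HD u v y) (H0 y)).
rewrite -mulmxA [RHS]mxE; apply: eq_bigr => i _; rewrite HZ mxE; congr (_ * _).
rewrite {1}[y]cV_sum_delta (big_morph _ (HDr _) (H0r _)) mxE; apply: eq_bigr => j _.
by rewrite HZr !mxE mulrC.
Qed.

Lemma symp_basis_J (L : 'cV[C]_n -> Prop) H (G : 'M[C]_n) u v :
    (forall x y, H x y = (x^T *m G *m cjmx y) 0 0) -> symp_basis L H u v ->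
  ImM ((fam_mx (cat_fam u v))^T *m G *m cjmx (fam_mx (cat_fam u v))) = Jmx R n.
Proof.
move=> HG [_ _ Q]; apply/matrixP => k l; rewrite mxE -sesqui_col -HG !col_fam.
rewrite /cat_fam /Jmx -[complex.Im _]/(Qform H _ _).
rewrite -{2}(splitK k) -{2}(splitK l).
case: (split k) => i; case: (split l) => j; case: (Q i j) => q1 q2 q3 q4 /=.
- by rewrite block_mxEul mxE.
- by rewrite block_mxEur mxE.
- by rewrite block_mxEdl !mxE.
- by rewrite block_mxEdr mxE.
Qed.

(** The [V]-[V] block of [J] makes [T = V^T G V^*] real. The [U]-[V] block shows that [V a] is
    nonzero for real nonzero [a], so [T] is positive definite and [V] invertible. Writing [U = V Z],
    the [U]-[V] block gives [Im Z = T^-1] and the [U]-[U] block gives the symmetry of [Re Z]. *)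
Lemma period_normal_form (G U V : 'M[C]_n) :
    G^T = cjmx G -> (forall x : 'cV[C]_n, x != 0 -> 0 < (x^T *m G *m cjmx x) 0 0) ->
    ImM ((row_mx U V)^T *m G *m cjmx (row_mx U V)) = Jmx R n ->
  [/\ V \in unitmx, siegel (invmx V *m U) & V^T *m G *m cjmx V = herm (invmx V *m U)].
Proof.
move=> G_herm G_pos.
rewrite cjmx_row tr_row_mx mul_col_mx mul_mx_row !mul_col_mx /ImM.
rewrite map_row_mx !map_col_mx -!/(ImM _) /Jmx block_mxEh => /eq_row_mx[].
move=> /eq_col_mx[ImUU _] /eq_col_mx[ImUV ImVV].
pose T := ReM (V^T *m G *m cjmx V).
have TE : V^T *m G *m cjmx V = realmxC T by apply: eqmxC; rewrite ?ReM_real ?ImM_real.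
have T_sym : T^T = T.
  rewrite /T -ReM_tr !trmx_mul trmxK G_herm -[in RHS]ReM_cj !cjmxM cjmxK cjmx_tr.
  by rewrite -mulmxA.
have T_pos : posdefR T.
  move=> a a0.
  have Va0 : V *m realmxC a != 0.
    apply: contra a0 => /eqP Va; apply/eqP.
    have <- : ImM (U^T *m G *m cjmx V *m realmxC a) = a.
      by rewrite ImM_mul ReM_real ImM_real mulmx0 add0r ImUV mul1mx.
    by rewrite -cjmx_real -mulmxA -cjmxM Va /cjmx map_mx0 mulmx0 ImM0.
  have := G_pos _ Va0.
  have -> : (V *m realmxC a)^T *m G *m cjmx (V *m realmxC a) = realmxC (a^T *m T *m a).
    by rewrite !realmxCM -TE cjmxM cjmx_real trmx_mul realmxC_tr !mulmxA.
  by rewrite mxE /realC ltcR.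
have T_unit := posdefR_unit T_pos.
have V_unit : V \in unitmx.
  have : realmxC (invmx T) *m (V^T *m G) *m cjmx V = 1%:M.
    by rewrite -mulmxA TE -realmxCM mulVmx // /realmxC map_mx1.
  by move/(congr1 (@cjmx R _ _)); rewrite cjmxM cjmxK cjmx1 => /mulmx1_unit[].
have UE : U = V *m (invmx V *m U) by rewrite mulKVmx.
move: UE ImUU ImUV; move: (invmx V *m U) => Z -> ImZZ ImZ.
have {}ImZ : (ImM Z)^T *m T = 1%:M.
  by rewrite -ImZ trmx_mul -!mulmxA (mulmxA V^T) TE ImM_mul ReM_real ImM_real mulmx0 add0r ImM_tr.
have TY : T *m ImM Z = 1%:M by rewrite -[LHS]trmxK trmx_mul T_sym ImZ trmx1.
have YE : ImM Z = invmx T by rewrite -[LHS](mulKmx T_unit) TY mulmx1.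
have Y_sym : (ImM Z)^T = ImM Z by rewrite YE trmx_inv T_sym.
have Z_sym : Z^T = Z.
  apply: eqmxC; rewrite ?ImM_tr // ReM_tr.
  have := ImZZ; have -> : (V *m Z)^T *m G *m cjmx (V *m Z) = Z^T *m realmxC T *m cjmx Z.
    by rewrite -TE cjmxM trmx_mul !mulmxA.
  rewrite !(ImM_mul, ReM_mul) ReM_real ImM_real ReM_cj ImM_cj ReM_tr ImM_tr.
  rewrite !mulmx0 subr0 add0r mulmxN ImZ mul1mx -mulmxA TY mulmx1 addrC.
  by move/eqP; rewrite subr_eq0 => /eqP.
split=> //; last by rewrite TE /herm YE invmxK.
by split; rewrite // YE; apply: posdefR_inv.
Qed.

End Uniformization.

(** A compatible lift gives a symplectic basis [B = (U V)]; multiplication by [V^-1] carries it to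
    [(Z 1)]. The integral matrix [E] of the real structure in this basis reverses [J] and is [tau]
    modulo [N], so [E tau] is the transpose of an element of [Gamma(N)]. *)
Lemma real_ppav_uniformization (R : realType) (N n : nat) (A : pav_data R n) :
    (4 <= N)%N -> real_ppav_level N A ->
  exists (Z : 'M[R[i]]_n) (g : 'M[int]_(n + n)),
    [/\ siegel Z, GammaN N g, sp_act (intmxC R g) Z = - cjmx Z &
        pav_isomorphic N A (A_Z N g Z)].
Proof.
move=> N4 [[_ H_pos _] [kD kZ kK kL kQ] _ [u [v [lift compat]]]].
have [sb _] := lift; have [LB _ _] := sb.
have [G G_herm HG] := hermitian_mx H_pos.
have [K0 kE] := antilinear_mx kD kZ.
have BJ := symp_basis_J HG sb.
set B := fam_mx (cat_fam u v) in BJ.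
have {}LB x : pL A x <-> exists k, x = B *m intmxC R k.
  by apply: iff_trans (LB x) (Z_spanE _ _).
have G_pos (x : 'cV[R[i]]_n) : x != 0 -> 0 < (x^T *m G *m cjmx x) 0 0.
  by rewrite -HG; case: H_pos => _ _ _; apply.
have [V_unit sZ TZ] : let V := fam_mx v in let U := fam_mx u in
    [/\ V \in unitmx, siegel (invmx V *m U) & V^T *m G *m cjmx V = herm (invmx V *m U)].
  by apply: period_normal_form => //; rewrite -fam_cat.
set V := fam_mx v in V_unit sZ TZ; set Z := invmx V *m fam_mx u in sZ TZ.
pose P := invmx V.
have P_unit : P \in unitmx by rewrite unitmx_inv.
have PB : P *m B = period Z by rewrite /B fam_cat mul_mx_row mulVmx.
have PG : P^T *m herm Z *m cjmx P = G.
  rewrite -TZ /P !mulmxA -trmx_mul mulmxV // trmx1 mul1mx -mulmxA -cjmxM mulmxV //.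
  by rewrite cjmx1 mulmx1.
have [E BE] : exists E, K0 *m cjmx B = B *m intmxC R E.
  have /int_cols_exist[E EE] (k : 'I_(n + n)) :
      exists c, pk A (col k B) = B *m intmxC R c.
    apply/LB/kL; exists (col k B); split=> //; apply/LB; exists (delta_mx k 0).
    by rewrite /intmxC map_delta_mx -colE.
  exists E; apply: eq_cols => k; rewrite !col_mulmx.
  have -> : col k (cjmx B) = cjmx (col k B) by rewrite /cjmx map_col.
  by rewrite -kE EE /intmxC map_col.
have KE : P *m K0 *m cjmx V *m cjmx (period Z) = period Z *m intmxC R E.
  have VPB : V *m (P *m B) = B by rewrite mulKVmx.
  by rewrite -mulmxA -cjmxM -PB VPB -!mulmxA BE.
have E_J : E^T *m Jmx int n *m E = - Jmx int n.
  apply: (@intmxR_inj R); rewrite !intmxRM intmxR_J.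
  have -> : intmxR R (- Jmx int n) = - Jmx R n.
    by rewrite -intmxR_J; apply/matrixP => i j; rewrite !mxE rmorphN.
  rewrite -BJ -ImM_sandwich.
  transitivity (ImM ((K0 *m cjmx B)^T *m G *m cjmx (K0 *m cjmx B))).
    by rewrite BE cjmxM cjmx_int trmx_mul !realmxC_int intmxC_tr !mulmxA.
  apply/matrixP => k l.
  rewrite [LHS]mxE [RHS]mxE [X in - X]mxE -(sesqui_col _ _ G k l) -(sesqui_col B B G k l).
  rewrite !col_mulmx.
  have -> : col k (cjmx B) = cjmx (col k B) by rewrite /cjmx map_col.
  have -> : col l (cjmx B) = cjmx (col l B) by rewrite /cjmx map_col.
  by rewrite -!kE -!HG; apply: kQ.
have E_tau : cgr N E (tau n).
  have /int_cols_exist[D DE] (k : 'I_(n + n)) :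
      exists d, col k E = col k (tau n) + N%:Z *: d.
    (* Compatibility says that on [N]-torsion the real structure acts as [tau]: by [-1] on the [u]
       half and by [1] on the [v] half. *)
    have [d dE] : exists d, pk A (Ninv R N *: col k B)
        - Ninv R N *: (B *m intmxC R (col k (tau n))) = B *m intmxC R d.
      apply/LB; case: (splitP k) => i ki.
        have kl : k = lshift n i by apply: val_inj.
        have := (compat i).1; rewrite kl [col _ (tau n)]colE tau_lshift.
        rewrite /intmxC map_mxN map_delta_mx mulmxN scalerN opprK -colE.
        by rewrite (_ : col _ B = u i) // col_fam /cat_fam (unsplitK (inl _ i)).
      have kr : k = rshift n i by apply: val_inj.
      have := (compat i).2; rewrite kr [col _ (tau n)]colE tau_rshift /intmxC map_delta_mx -colE.
      by rewrite (_ : col _ B = v i) // col_fam /cat_fam (unsplitK (inr _ i)).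
    exists d; apply: (period_int_inj sZ); rewrite -PB -!mulmxA; congr (_ *m _).
    have := congr1 ( *:%R (N%:R : R[i])) dE.
    rewrite kZ kE scalerBr /Ninv fmorphV rmorph_nat !scalerA -/(Ninv R N).
    rewrite mulrC Ninv_mul // !scale1r.
    have -> : K0 *m cjmx (col k B) = B *m intmxC R (col k E).
      by rewrite /cjmx map_col -/(cjmx _) -col_mulmx BE col_mulmx /intmxC map_col.
    move/eqP; rewrite subr_eq addrC => /eqP ->.
    rewrite /intmxC map_mxD map_mxZ -/(intmxC R _) mulmxDr; congr (_ + _).
    by rewrite -scalemxAr.
  exists D; apply: eq_cols => k; rewrite DE; apply/matrixP => i j.
  by rewrite ord1 !mxE.
pose g := (E *m tau n)^T.
have gE : g^T *m tau n = E by rewrite trmxK -mulmxA tauK mulmx1.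
have gG : GammaN N g.
  apply: GammaN_tr; apply/GammaNE; split; last first.
    by rewrite -(tauK n); apply: cgrM => //; apply: cgr_refl.
  rewrite /symplectic_int trmx_mul tau_tr.
  have -> : tau n *m E^T *m Jmx int n *m (E *m tau n)
          = tau n *m (E^T *m Jmx int n *m E) *m tau n by rewrite !mulmxA.
  by rewrite E_J mulmxN mulNmx tau_J opprK.
have [g_sp _] := gG.
have gZ : sp_act (intmxC R g) Z = - cjmx Z.
  apply: (@sp_act_period _ _ _ _ _ (P *m K0 *m cjmx V)) => //; first exact: siegel_cjN.
  by rewrite period_cjN mulmxA KE -mulmxA -intmxCM trmxK.
(* The transported real structure and [kappa_Z g Z] have the same integral matrix [E] on the
   periods, so they are equal. *)
have KZ : (denom g Z)^T = P *m K0 *m cjmx V.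
  have := (sp_act_cjN sZ g_sp).1 gZ; rewrite gE -KE => /(congr1 (@cjmx R _ _)).
  rewrite cjmxM cjmxM cjmxK => /mul_period_inj; exact: (can_inj (@cjmxK R n n)).
exists Z, g; split=> //; exists P; split=> //=.
- move=> x; split=> [/L_ZE[k ->]|[y [/LB[k ->] ->]]].
    by exists (B *m intmxC R k); split; [apply/LB; exists k|rewrite mulmxA PB].
  by apply/L_ZE; exists k; rewrite mulmxA PB.
- by move=> x y; rewrite HG -PG /H_Z -/(herm Z) cjmxM trmx_mul !mulmxA.
- by move=> x; rewrite kE /kappa_Z -/(denom g Z) KZ /P invmxK cjmxM !mulmxA.
exists u, v, (std_u Z), (std_v Z); split=> //; first exact: std_level_lift.
have PU i : P *m u i = std_u Z i.
  by rewrite /std_u -PB col_mulmx col_fam /cat_fam (unsplitK (inl _ i)).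
have PV i : P *m v i = std_v Z i.
  by rewrite /std_v -PB col_mulmx col_fam /cat_fam (unsplitK (inr _ i)).
by move=> i; rewrite -!scalemxAr PU PV !subrr; split; apply: L_Z0.
Qed.

Theorem theorem6p6 (R : realType) (m N n : nat) (hm : (0 < m)%N) (hN : N = (4 * m)%N) :
  [/\ (* uniqueness of gamma *)
      forall Z : 'M[R[i]]_n, in_S N Z ->
        exists! g : 'M[int]_(n + n), GammaN N g /\ sp_act (intmxC R g) Z = - cjmx Z,
      (* A_Z is a real ppav with level N structure *)
      forall (Z : 'M[R[i]]_n) (g : 'M[int]_(n + n)),
        siegel Z -> GammaN N g -> sp_act (intmxC R g) Z = - cjmx Z ->
        real_ppav_level N (A_Z N g Z),
      (* Z |-> A_Z is well defined and injective on Gamma(N)-orbits of S (= points of X_R) *)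
      forall (Z Z' : 'M[R[i]]_n) (g g' : 'M[int]_(n + n)),
        siegel Z -> GammaN N g -> sp_act (intmxC R g) Z = - cjmx Z ->
        siegel Z' -> GammaN N g' -> sp_act (intmxC R g') Z' = - cjmx Z' ->
        ((exists h : 'M[int]_(n + n), GammaN N h /\ Z' = sp_act (intmxC R h) Z) <->
         pav_isomorphic N (A_Z N g Z) (A_Z N g' Z'))
    & (* surjective onto isomorphism classes *)
      forall A : pav_data R n, real_ppav_level N A ->
        exists (Z : 'M[R[i]]_n) (g : 'M[int]_(n + n)),
          [/\ siegel Z, GammaN N g, sp_act (intmxC R g) Z = - cjmx Z &
              pav_isomorphic N A (A_Z N g Z)]].
Proof.
(* This bound feeds the contraction in [minkowski]. *)
have N4 : (4 <= N)%N by rewrite hN leq_pmulr.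
split.
- move=> Z [sZ [g [gG gZ]]]; exists g; split=> // g' [g'G g'Z].
  exact: conj_act_inj N4 _ _ _ sZ gG g'G gZ g'Z.
- by move=> Z g; apply: A_Z_real_ppav.
- move=> Z Z' g g' sZ gG gZ sZ' g'G g'Z'; split=> [[h [hG hZ]]|[P PI]].
    exact: orbit_pav_iso hG hZ.
  exact: pav_iso_orbit PI.
- by move=> A; apply: real_ppav_uniformization.
Qed.
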